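(* Let $Q$ be a regular multiplier Hopf algebra, let $A$ be a $Q$-bimodule algebra and let $B$ be a $Q$-bicomodule algebra. Then there are algebra isomorphisms $$B\diamond^Q_r A\;\cong\; B\star^Q_r A\qquad\text{and}\qquad A\diamond^Q_l B\;\cong\; A\star^Q_l B .$$
   Context: Algebras are associative over a field $k$, not necessarily unital, with non-degenerate product and with local units; $M(A)$ is the multiplier algebra of $A$. A multiplier Hopf algebra is an algebra $Q$ with a homomorphism $\Delta:Q\to M(Q\otimes Q)$ such that $T_1(x\otimes y)=\Delta(x)(1\otimes y)$ and $T_2(x\otimes y)=(x\otimes 1)\Delta(y)$ lie in $Q\otimes Q$, $(T_2\otimes \mathrm{id})(\mathrm{id}\otimes T_1)=(\mathrm{id}\otimes T_1)(T_2\otimes \mathrm{id})$, and $T_1,T_2$ are bijective on $Q\otimes Q$. It is regular if $(Q,\tau\Delta)$, with $\tau$ the flip, is also a multiplier Hopf algebra; then its antipode $S$ is a bijection of $Q$. Sweedler notation $\Delta(x)=\sum x_1\otimes x_2$ is used with the usual covering conventions. Modules are unital ($Q\rhd A=A$, $A\lhd Q=A$). $A$ is a left $Q$-module algebra if $x\rhd(ab)=\sum(x_1\rhd a)(x_2\rhd b)$, a right $Q$-module algebra if $(ab)\lhd x=\sum(a\lhd x_1)(b\lhd x_2)$, and a $Q$-bimodule algebra if it is both and $(x\rhd a)\lhd y=x\rhd(a\lhd y)$. A left $Q$-comodule algebra is an algebra $B$ with an injective homomorphism $\Gamma:B\to M(Q\otimes B)$, written $\Gamma(b)=\sum b_{(-1)}\otimes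 b_0$, such that $\Gamma(b)(x\otimes 1),(x\otimes1)\Gamma(b)\in Q\otimes B$ and $(\mathrm{id}\otimes\Gamma)\Gamma=(\Delta\otimes\mathrm{id})\Gamma$. A right $Q$-comodule algebra is defined symmetrically with $\Upsilon:B\to M(B\otimes Q)$, $\Upsilon(b)=\sum b_0\otimes b_{(1)}$. A $Q$-bicomodule algebra is both, with $(\mathrm{id}\otimes\Upsilon)\Gamma=(\Gamma\otimes\mathrm{id})\Upsilon$ (suitably covered); then one writes $\sum b_{(-1)}\otimes b_0\otimes b_{(1)}$ for the common value on $b$. The four algebras are defined on the indicated tensor product spaces by the following multiplications ($a,a'\in A$, $b,b'\in B$): $B\star^Q_rA=B\otimes A$: $(b'\star a')(b\star a)=\sum b'b_0\star(S^{-1}(b_{(-1)})\rhd a'\lhd b_{(1)})a$; $A\star^Q_lB=A\otimes B$: $(a\star b)(a'\star b')=\sum a(b_{(-1)}\rhd a'\lhd S^{-1}(b_{(1)}))\star b_0b'$; $B\diamond^Q_rA=B\otimes A$: $(b'\diamond a')(b\diamond a)=\sum b'_0b_0\diamond(a'\lhd b_{(1)})(b'_{(-1)}\rhd a)$; $A\diamond^Q_lB=A\otimes B$: $(a\diamond b)(a'\diamond b')=\sum(a\lhd b'_{(1)})(b_{(-1)}\rhd a')\diamond b_0b'_0$. *)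

(* Defs.v *)
From HB Require Import structures.
From mathcomp Require Import all_boot all_order all_algebra.
From mathcomp Require Import generic_quotient.
From mathcomp Require Import boolp classical_sets.

Set Implicit Arguments.
Unset Strict Implicit.
Unset Printing Implicit Defensive.

Import GRing.Theory.
Local Open Scope ring_scope.
Local Open Scope quotient_scope.
Local Open Scope classical_set_scope.

Reserved Notation "x ** y" (at level 40, left associativity).
Reserved Notation "v ⊗ w" (at level 40, left associativity).
Reserved Notation "\tsum_ ( x , y <- t ) E"
  (at level 41, E at level 41, x, y, t at level 50,
   format "'[' \tsum_ ( x ,  y  <-  t ) '/  '  E ']'").

Notation bilinear2 f := (bilinear_for *:%R *:%R f).

Section Tensor.
Variables (k : fieldType) (V W : lmodType k).
Implicit Types (s : seq (V * W)).

(* A list of pairs stands for the sum of the corresponding pure tensors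
   (scalars can be absorbed into either component); two lists are identified
   when no bilinear map distinguishes them. *)
Definition tens_rel s s' : Prop :=
  forall (Z : lmodType k) (f : V -> W -> Z), bilinear2 f ->
    \sum_(p <- s) f p.1 p.2 = \sum_(p <- s') f p.1 p.2.

Definition tens_eq : rel (seq (V * W)) := fun s s' => `[< tens_rel s s' >].

Lemma tens_eq_refl : reflexive tens_eq.
Proof. by move=> s; apply/asboolP. Qed.
Lemma tens_eq_sym : symmetric tens_eq.
Proof.
by move=> s s'; apply/asboolP/asboolP => h Z f bf; rewrite h.
Qed.
Lemma tens_eq_trans : transitive tens_eq.
Proof.
move=> s2 s1 s3 /asboolP h1 /asboolP h2; apply/asboolP => Z f bf.
by rewrite h1 // h2.
Qed.
Canonical tens_equiv := EquivRel tens_eq tens_eq_refl tens_eq_sym tens_eq_trans.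

Definition tensor := {eq_quot tens_equiv}.
HB.instance Definition _ := Choice.on tensor.
HB.instance Definition _ := EqQuotient.on tensor.
Implicit Types (t : tensor).

Definition tpure (v : V) (w : W) : tensor := \pi_tensor [:: (v, w)].

(* [tsum f t] is the sum of the [f v_i w_i] when t is the sum of the v_i ⊗ w_i;
   for bilinear f it does not depend on the expression of t, see [tsumE] and
   [tsum_linear].  It renders Sweedler-type sums. *)
Definition tsum (Z : lmodType k) (f : V -> W -> Z) t : Z :=
  \sum_(p <- repr t) f p.1 p.2.

Lemma tsum_pi (Z : lmodType k) (f : V -> W -> Z) s :
  bilinear2 f -> tsum f (\pi_tensor s) = \sum_(p <- s) f p.1 p.2.
Proof.
move=> bf; rewrite /tsum; case: piP => s' /eqmodP /asboolP h.
by rewrite (h _ _ bf).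
Qed.

Lemma tens_ext t t' :
  (forall (Z : lmodType k) (f : V -> W -> Z), bilinear2 f ->
     tsum f t = tsum f t') -> t = t'.
Proof.
move=> h; rewrite -(reprK t) -(reprK t'); apply/eqmodP/asboolP => Z f bf.
exact: h.
Qed.

Definition tadd t t' : tensor := \pi_tensor (repr t ++ repr t').
Definition tscale (c : k) t : tensor :=
  \pi_tensor [seq (c *: p.1, p.2) | p <- repr t].

Lemma tsum_tadd (Z : lmodType k) (f : V -> W -> Z) t t' :
  bilinear2 f -> tsum f (tadd t t') = tsum f t + tsum f t'.
Proof. by move=> bf; rewrite tsum_pi // big_cat. Qed.

Lemma bilinear2_ZDl (Z : lmodType k) (f : V -> W -> Z) : bilinear2 f ->
  forall c v w, f (c *: v) w = c *: f v w.
Proof. by case=> h _ c v w; apply: (scalable_linear (h w)). Qed.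

Lemma tsum_tscale (Z : lmodType k) (f : V -> W -> Z) c t :
  bilinear2 f -> tsum f (tscale c t) = c *: tsum f t.
Proof.
move=> bf; rewrite tsum_pi // big_map scaler_sumr.
by apply: eq_bigr => p _ /=; rewrite bilinear2_ZDl.
Qed.

Let t0 : tensor := \pi_tensor [::].
Let tsum_t0 (Z : lmodType k) (f : V -> W -> Z) : bilinear2 f -> tsum f t0 = 0.
Proof. by move=> bf; rewrite tsum_pi // big_nil. Qed.

Let taddA : associative tadd.
Proof. by move=> *; apply: tens_ext => Z f bf; rewrite !tsum_tadd // addrA. Qed.
Let taddC : commutative tadd.
Proof. by move=> *; apply: tens_ext => Z f bf; rewrite !tsum_tadd // addrC. Qed.
Let tadd0 : left_id t0 tadd.
Proof.
by move=> *; apply: tens_ext => Z f bf; rewrite tsum_tadd // tsum_t0 // add0r.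
Qed.
Let taddN : left_inverse t0 (tscale (- 1)) tadd.
Proof.
move=> t; apply: tens_ext => Z f bf.
by rewrite tsum_tadd // tsum_tscale // tsum_t0 // scaleN1r addNr.
Qed.

HB.instance Definition _ := GRing.isZmodule.Build tensor taddA taddC tadd0 taddN.

Let tscaleA c d t : tscale c (tscale d t) = tscale (c * d) t.
Proof. by apply: tens_ext => Z f bf; rewrite !tsum_tscale // scalerA. Qed.
Let tscale1 : left_id 1 tscale.
Proof. by move=> t; apply: tens_ext => Z f bf; rewrite tsum_tscale // scale1r. Qed.
Let tscaleDr : right_distributive tscale +%R.
Proof.
move=> c t t'; apply: tens_ext => Z f bf.
by rewrite tsum_tscale // !tsum_tadd // !tsum_tscale // scalerDr.
Qed.
Let tscaleDl t : {morph tscale^~ t : c d / c + d}.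
Proof.
move=> c d; apply: tens_ext => Z f bf.
by rewrite tsum_tscale // tsum_tadd // !tsum_tscale // scalerDl.
Qed.

HB.instance Definition _ :=
  GRing.Zmodule_isLmodule.Build k tensor tscaleA tscale1 tscaleDr tscaleDl.

Lemma tsum_linear (Z : lmodType k) (f : V -> W -> Z) :
  bilinear2 f -> linear (tsum f).
Proof. by move=> bf c t t'; rewrite tsum_tadd // tsum_tscale. Qed.

Lemma tsumE (Z : lmodType k) (f : V -> W -> Z) v w :
  bilinear2 f -> tsum f (tpure v w) = f v w.
Proof. by move=> bf; rewrite tsum_pi // big_seq1. Qed.

Lemma tpure_bilinear : bilinear2 tpure.
Proof.
split=> [w c v v'|v c w w']; apply: tens_ext => Z f bf;
  rewrite [RHS]tsum_tadd // tsum_tscale // !tsumE //.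
- exact: (bf.1 w).
- exact: (bf.2 v).
Qed.

End Tensor.
Arguments tensor {k} (V W)%_type_scope.

Notation "V ⊗ W" := (tensor V W) : type_scope.
Notation "v ⊗ w" := (tpure v w) : ring_scope.
Notation "\tsum_ ( x , y <- t ) E" := (tsum (fun x y => E) t) : ring_scope.

Section TensorTheory.
Variable k : fieldType.
Implicit Types U V W Z : lmodType k.

Lemma lin_sum Z Z' (g : Z -> Z') I (r : seq I) (F : I -> Z) :
  linear g -> g (\sum_(i <- r) F i) = \sum_(i <- r) g (F i).
Proof.
move=> lg; pose G : {linear Z -> Z'} :=
  HB.pack g (GRing.isLinear.Build _ _ _ _ _ (lg : GRing.linear_for *:%R g)).
exact: (raddf_sum G).
Qed.

Lemma lin_tsum V W Z Z' (g : Z -> Z') (f : V -> W -> Z) (t : V ⊗ W) :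
  linear g -> g (tsum f t) = \tsum_(v, w <- t) g (f v w).
Proof. exact: lin_sum. Qed.

Lemma tsum_tpure V W (t : V ⊗ W) : \tsum_(v, w <- t) v ⊗ w = t.
Proof.
apply: tens_ext => Z f bf; rewrite lin_tsum; last exact: tsum_linear.
by apply: eq_bigr => p _; rewrite tsumE.
Qed.

Lemma tens_lin_ext V W Z (g h : V ⊗ W -> Z) :
  linear g -> linear h -> (forall v w, g (v ⊗ w) = h (v ⊗ w)) -> g =1 h.
Proof.
move=> lg lh gh t; rewrite -(tsum_tpure t) !lin_tsum //.
by apply: eq_bigr => p _; apply: gh.
Qed.

Definition tmap V V' W W' (f : V -> V') (g : W -> W') (t : V ⊗ W) : V' ⊗ W' :=
  \tsum_(v, w <- t) f v ⊗ g w.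
Definition tswap V W (t : V ⊗ W) : W ⊗ V := \tsum_(v, w <- t) w ⊗ v.
Definition tassoc U V W (t : (U ⊗ V) ⊗ W) : U ⊗ (V ⊗ W) :=
  \tsum_(s, w <- t) \tsum_(u, v <- s) u ⊗ (v ⊗ w).
Definition tassocV U V W (t : U ⊗ (V ⊗ W)) : (U ⊗ V) ⊗ W :=
  \tsum_(u, s <- t) \tsum_(v, w <- s) (u ⊗ v) ⊗ w.

End TensorTheory.

HB.mixin Record Lmodule_isNonunitalAlgebra (k : fieldType) V
    of GRing.Lmodule k V := {
  nmul : V -> V -> V;
  nmulA : associative nmul;
  nmul_bilinear : bilinear2 nmul
}.

#[short(type="nalgType")]
HB.structure Definition NonunitalAlgebra (k : fieldType) :=
  {V of GRing.Lmodule k V & Lmodule_isNonunitalAlgebra k V}.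

Notation "x ** y" := (nmul x y) : ring_scope.

Section BilinearTools.
Variable k : fieldType.
Implicit Types U V W Z : lmodType k.

Lemma bilinear2P V W Z (f : V -> W -> Z) :
  (forall c v v' w, f (c *: v + v') w = c *: f v w + f v' w) ->
  (forall c v w w', f v (c *: w + w') = c *: f v w + f v w') -> bilinear2 f.
Proof. by move=> hl hr; split=> [w c v v'|v c w w'] /=; [apply: hl|apply: hr]. Qed.

Section Bilinear.
Variables (V W Z : lmodType k) (f : V -> W -> Z).
Hypothesis bf : bilinear2 f.
Lemma bilDl c v v' w : f (c *: v + v') w = c *: f v w + f v' w.
Proof. exact: (bf.1 w). Qed.
Lemma bilDr c v w w' : f v (c *: w + w') = c *: f v w + f v w'.
Proof. exact: (bf.2 v). Qed.
End Bilinear.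

Lemma tens_bilin_ext V W V' W' Z (f g : V ⊗ W -> V' ⊗ W' -> Z) :
  bilinear2 f -> bilinear2 g ->
  (forall v w v' w', f (v ⊗ w) (v' ⊗ w') = g (v ⊗ w) (v' ⊗ w')) ->
  forall s t, f s t = g s t.
Proof.
move=> bf bg fg s t; move: s; apply: tens_lin_ext => [||v w].
- exact: bf.1.
- exact: bg.1.
move: t; apply: tens_lin_ext => [||v' w']; last exact: fg.
- exact: bf.2.
- exact: bg.2.
Qed.

Lemma tsum_funD V W Z (f g : V -> W -> Z) c (t : V ⊗ W) :
  \tsum_(v, w <- t) (c *: f v w + g v w) = c *: tsum f t + tsum g t.
Proof. by rewrite /tsum big_split scaler_sumr. Qed.

Lemma eq_tsum V W Z (f g : V -> W -> Z) (t : V ⊗ W) :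
  (forall v w, f v w = g v w) -> tsum f t = tsum g t.
Proof. by move=> fg; apply: eq_bigr => p _; apply: fg. Qed.

Lemma linear_comp V W Z (f : W -> Z) (g : V -> W) :
  linear f -> linear g -> linear (f \o g).
Proof. by move=> lf lg c u v /=; rewrite lg lf. Qed.

Lemma tpureDl V W c (v v' : V) (w : W) :
  (c *: v + v') ⊗ w = c *: (v ⊗ w) + v' ⊗ w.
Proof. exact: (bilDl (@tpure_bilinear k V W)). Qed.
Lemma tpureDr V W c (v : V) (w w' : W) :
  v ⊗ (c *: w + w') = c *: (v ⊗ w) + v ⊗ w'.
Proof. exact: (bilDr (@tpure_bilinear k V W)). Qed.

Lemma tmap_bilinear V V' W W' (f : V -> V') (g : W -> W') :
  linear f -> linear g -> bilinear2 (fun v w => f v ⊗ g w).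
Proof.
move=> lf lg; apply: bilinear2P => [c v v' w|c v w w'].
  by rewrite lf tpureDl.
by rewrite lg tpureDr.
Qed.
Lemma tmap_linear V V' W W' (f : V -> V') (g : W -> W') :
  linear f -> linear g -> linear (tmap f g).
Proof. by move=> lf lg; apply/tsum_linear/tmap_bilinear. Qed.
Lemma tmapE V V' W W' (f : V -> V') (g : W -> W') v w :
  linear f -> linear g -> tmap f g (v ⊗ w) = f v ⊗ g w.
Proof. by move=> lf lg; rewrite /tmap tsumE //; apply: tmap_bilinear. Qed.

Lemma tswap_bilinear V W : bilinear2 (fun (v : V) (w : W) => w ⊗ v).
Proof.
by apply: bilinear2P => [c v v' w|c v w w']; rewrite (tpureDr, tpureDl).
Qed.
Lemma tswap_linear V W : linear (@tswap k V W).
Proof. exact/tsum_linear/tswap_bilinear. Qed.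
Lemma tswapE V W (v : V) (w : W) : tswap (v ⊗ w) = w ⊗ v.
Proof. by rewrite /tswap tsumE //; apply: tswap_bilinear. Qed.
Lemma tswapK V W : cancel (@tswap k V W) (@tswap k W V).
Proof.
apply: tens_lin_ext => [||v w]; last by rewrite !tswapE.
- exact: (linear_comp (@tswap_linear W V) (@tswap_linear V W)).
- by [].
Qed.

End BilinearTools.

Section AlgebraTheory.
Variables (k : fieldType) (V : nalgType k).
Implicit Types u v w : V.
Lemma nmul_lin c u v w : (c *: u + v) ** w = c *: (u ** w) + v ** w.
Proof. exact: (bilDl (@nmul_bilinear k V)). Qed.
Lemma nmul_linr c u v w : u ** (c *: v + w) = c *: (u ** v) + u ** w.
Proof. exact: (bilDr (@nmul_bilinear k V)). Qed.
Lemma nmulDl u v w : (u + v) ** w = u ** w + v ** w.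
Proof. by have := nmul_lin 1 u v w; rewrite !scale1r. Qed.
Lemma nmulDr u v w : u ** (v + w) = u ** v + u ** w.
Proof. by have := nmul_linr 1 u v w; rewrite !scale1r. Qed.
Lemma nmul0l v : 0 ** v = 0 :> V.
Proof. by have := nmulDl 0 0 v; rewrite addr0 => /esym/(canRL (addKr _)) ->; rewrite addNr. Qed.
Lemma nmul0r v : v ** 0 = 0 :> V.
Proof. by have := nmulDr v 0 0; rewrite addr0 => /esym/(canRL (addKr _)) ->; rewrite addNr. Qed.
Lemma nmulZl c u v : (c *: u) ** v = c *: (u ** v).
Proof. by have := nmul_lin c u 0 v; rewrite nmul0l !addr0. Qed.
Lemma nmulZr c u v : u ** (c *: v) = c *: (u ** v).
Proof. by have := nmul_linr c u v 0; rewrite nmul0r !addr0. Qed.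
End AlgebraTheory.

Section TensorAlgebra.
Variables (k : fieldType) (V W : nalgType k).

Definition tmul (s t : V ⊗ W) : V ⊗ W :=
  \tsum_(v, w <- s) \tsum_(v', w' <- t) (v ** v') ⊗ (w ** w').

Let inner_bilinear v w :
  bilinear2 (fun (v' : V) (w' : W) => (v ** v') ⊗ (w ** w')).
Proof.
by apply: bilinear2P => [c v1 v2 w1|c v1 w1 w2]; rewrite nmul_linr (tpureDl, tpureDr).
Qed.

Let outer_bilinear t : bilinear2 (fun (v : V) (w : W) =>
  \tsum_(v', w' <- t) (v ** v') ⊗ (w ** w')).
Proof.
apply: bilinear2P => [c v1 v2 w1|c v1 w1 w2]; rewrite -tsum_funD;
  by apply: eq_tsum => v w; rewrite nmul_lin (tpureDl, tpureDr).
Qed.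

Let tmul_bilinear : bilinear2 tmul.
Proof.
apply: bilinear2P => [c s s' t|c s t t'].
  exact: (tsum_linear (outer_bilinear t)).
rewrite /tmul -tsum_funD; apply: eq_tsum => v w.
exact: (tsum_linear (inner_bilinear v w)).
Qed.

Let tmulE v w v' w' : tmul (v ⊗ w) (v' ⊗ w') = (v ** v') ⊗ (w ** w').
Proof. by rewrite /tmul tsumE // tsumE. Qed.

Let tmulA : associative tmul.
Proof.
move=> s t u; move: s; apply: tens_lin_ext => [c s s'|c s s'|v w].
- exact: (bilDl tmul_bilinear).
- by rewrite !(bilDl tmul_bilinear).
move: t; apply: tens_lin_ext => [c t t'|c t t'|v' w'].
- by rewrite (bilDl tmul_bilinear) (bilDr tmul_bilinear).
- by rewrite (bilDr tmul_bilinear) (bilDl tmul_bilinear).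
move: u; apply: tens_lin_ext => [c u u'|c u u'|v'' w''].
- by rewrite !(bilDr tmul_bilinear).
- by rewrite !(bilDr tmul_bilinear).
by rewrite !tmulE !nmulA.
Qed.

HB.instance Definition _ :=
  Lmodule_isNonunitalAlgebra.Build k (tensor V W) tmulA tmul_bilinear.

Lemma tens_mulE (v v' : V) (w w' : W) :
  (v ⊗ w) ** (v' ⊗ w') = (v ** v') ⊗ (w ** w').
Proof. exact: tmulE. Qed.

End TensorAlgebra.

#[local] Obligation Tactic := idtac.

Section Multiplier.
Variables (k : fieldType) (A : nalgType k).

(* [mactl m a] is m a and [mactr m a] is a m. *)
Record multiplier := Multiplier {
  mactl : A -> A;
  mactr : A -> A;
  mactl_linear : linear mactl;
  mactr_linear : linear mactr;
  mactlM : forall a b, mactl (a ** b) = mactl a ** b;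
  mactrM : forall a b, mactr (a ** b) = a ** mactr b;
  mactrl : forall a b, mactr a ** b = a ** mactl b
}.
Implicit Types (m n : multiplier) (a b : A).

HB.instance Definition _ := gen_eqMixin multiplier.
HB.instance Definition _ := gen_choiceMixin multiplier.

Lemma mult_ext m n : mactl m =1 mactl n -> mactr m =1 mactr n -> m = n.
Proof.
case: m n => [l r hl hr hlM hrM hrl] [l' r' hl' hr' hlM' hrM' hrl'] /=.
move=> /funext el /funext er; subst l' r'.
by congr Multiplier; apply: Prop_irrelevance.
Qed.

Program Definition madd m n := @Multiplier
  (fun a => mactl m a + mactl n a) (fun a => mactr m a + mactr n a) _ _ _ _ _.
Next Obligation.
by move=> m n c a b /=; rewrite !mactl_linear scalerDr addrACA.
Qed.
Next Obligation.
by move=> m n c a b /=; rewrite !mactr_linear scalerDr addrACA.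
Qed.
Next Obligation. by move=> m n a b /=; rewrite !mactlM nmulDl. Qed.
Next Obligation. by move=> m n a b /=; rewrite !mactrM nmulDr. Qed.
Next Obligation. by move=> m n a b /=; rewrite nmulDl nmulDr !mactrl. Qed.

Program Definition mzero := @Multiplier (fun=> 0) (fun=> 0) _ _ _ _ _.
Next Obligation. by move=> c a b /=; rewrite scaler0 addr0. Qed.
Next Obligation. by move=> c a b /=; rewrite scaler0 addr0. Qed.
Next Obligation. by move=> a b /=; rewrite nmul0l. Qed.
Next Obligation. by move=> a b /=; rewrite nmul0r. Qed.
Next Obligation. by move=> a b /=; rewrite nmul0r nmul0l. Qed.

Program Definition mscale (c : k) m := @Multiplier
  (fun a => c *: mactl m a) (fun a => c *: mactr m a) _ _ _ _ _.
Next Obligation.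
by move=> c m d a b /=; rewrite mactl_linear scalerDr !scalerA mulrC.
Qed.
Next Obligation.
by move=> c m d a b /=; rewrite mactr_linear scalerDr !scalerA mulrC.
Qed.
Next Obligation. by move=> c m a b /=; rewrite mactlM nmulZl. Qed.
Next Obligation. by move=> c m a b /=; rewrite mactrM nmulZr. Qed.
Next Obligation. by move=> c m a b /=; rewrite nmulZr nmulZl mactrl. Qed.

Let maddA : associative madd.
Proof. by move=> *; apply: mult_ext => a /=; rewrite addrA. Qed.
Let maddC : commutative madd.
Proof. by move=> *; apply: mult_ext => a /=; rewrite addrC. Qed.
Let madd0 : left_id mzero madd.
Proof. by move=> *; apply: mult_ext => a /=; rewrite add0r. Qed.
Let maddN : left_inverse mzero (mscale (- 1)) madd.
Proof. by move=> *; apply: mult_ext => a /=; rewrite scaleN1r addNr. Qed.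
HB.instance Definition _ :=
  GRing.isZmodule.Build multiplier maddA maddC madd0 maddN.

Let mscaleA c d m : mscale c (mscale d m) = mscale (c * d) m.
Proof. by apply: mult_ext => a /=; rewrite scalerA. Qed.
Let mscale1 : left_id 1 mscale.
Proof. by move=> m; apply: mult_ext => a /=; rewrite scale1r. Qed.
Let mscaleDr : right_distributive mscale +%R.
Proof. by move=> c m n; apply: mult_ext => a /=; rewrite scalerDr. Qed.
Let mscaleDl m : {morph mscale^~ m : c d / c + d}.
Proof. by move=> c d; apply: mult_ext => a /=; rewrite scalerDl. Qed.
HB.instance Definition _ := GRing.Zmodule_isLmodule.Build k multiplier
  mscaleA mscale1 mscaleDr mscaleDl.

Program Definition mmul m n := @Multiplier
  (mactl m \o mactl n) (mactr n \o mactr m) _ _ _ _ _.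
Next Obligation. by move=> m n c a b /=; rewrite !mactl_linear. Qed.
Next Obligation. by move=> m n c a b /=; rewrite !mactr_linear. Qed.
Next Obligation. by move=> m n a b /=; rewrite !mactlM. Qed.
Next Obligation. by move=> m n a b /=; rewrite !mactrM. Qed.
Next Obligation. by move=> m n a b /=; rewrite !mactrl. Qed.

Let mmulA : associative mmul.
Proof. by move=> *; apply: mult_ext => a. Qed.
Let mmul_bilinear : bilinear2 mmul.
Proof.
apply: bilinear2P => [c m m' n|c m n n']; apply: mult_ext => a //=.
  by rewrite mactr_linear.
by rewrite mactl_linear.
Qed.
HB.instance Definition _ :=
  Lmodule_isNonunitalAlgebra.Build k multiplier mmulA mmul_bilinear.

Program Definition mone := @Multiplier id id _ _ _ _ _.
Next Obligation. by []. Qed.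
Next Obligation. by []. Qed.
Next Obligation. by []. Qed.
Next Obligation. by []. Qed.
Next Obligation. by []. Qed.

Program Definition memb a := @Multiplier (nmul a) (fun b => b ** a) _ _ _ _ _.
Next Obligation. by move=> a c b b' /=; rewrite nmul_linr. Qed.
Next Obligation. by move=> a c b b' /=; rewrite nmul_lin. Qed.
Next Obligation. by move=> a b b' /=; rewrite nmulA. Qed.
Next Obligation. by move=> a b b' /=; rewrite nmulA. Qed.
Next Obligation. by move=> a b b' /=; rewrite nmulA. Qed.

(* [m] belongs to the copy of A inside M(A) *)
Definition inA m : Prop := exists a, m = memb a.

(* the element of A that [m] is (unique when A is nondegenerate), if inA m *)
Definition elt m : A := xget 0 [set a | m = memb a].

End Multiplier.
Arguments multiplier {k} A%_type_scope.
Arguments mone {k A}.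

Lemma tswapM (k : fieldType) (V W : nalgType k) (s t : V ⊗ W) :
  tswap (s ** t) = tswap s ** tswap t.
Proof.
move: s t; apply: tens_bilin_ext => [||v w v' w'].
- by apply: bilinear2P => *; rewrite (nmul_lin, nmul_linr) tswap_linear.
- by apply: bilinear2P => *; rewrite tswap_linear (nmul_lin, nmul_linr).
by rewrite tens_mulE !tswapE tens_mulE.
Qed.

Section TensorMultiplier.
Variables (k : fieldType) (V W : nalgType k).

Section MTens.
Variables (m : multiplier V) (n : multiplier W).

Let L := tmap (mactl m) (mactl n).
Let R := tmap (mactr m) (mactr n).
Let L_lin : linear L.
Proof. by apply: tmap_linear; apply: mactl_linear. Qed.
Let R_lin : linear R.
Proof. by apply: tmap_linear; apply: mactr_linear. Qed.
Let LE v w : L (v ⊗ w) = mactl m v ⊗ mactl n w.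
Proof. by apply: tmapE; apply: mactl_linear. Qed.
Let RE v w : R (v ⊗ w) = mactr m v ⊗ mactr n w.
Proof. by apply: tmapE; apply: mactr_linear. Qed.

Let LM s t : L (s ** t) = L s ** t.
Proof.
move: s t; apply: tens_bilin_ext => [||v w v' w'].
- by apply: bilinear2P => *; rewrite (nmul_lin, nmul_linr) L_lin.
- by apply: bilinear2P => *; rewrite ?L_lin (nmul_lin, nmul_linr).
by rewrite tens_mulE !LE tens_mulE !mactlM.
Qed.
Let RM s t : R (s ** t) = s ** R t.
Proof.
move: s t; apply: tens_bilin_ext => [||v w v' w'].
- by apply: bilinear2P => *; rewrite (nmul_lin, nmul_linr) R_lin.
- by apply: bilinear2P => *; rewrite ?R_lin (nmul_lin, nmul_linr).
by rewrite tens_mulE !RE tens_mulE !mactrM.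
Qed.
Let RL s t : R s ** t = s ** L t.
Proof.
move: s t; apply: tens_bilin_ext => [||v w v' w'].
- by apply: bilinear2P => *; rewrite ?R_lin (nmul_lin, nmul_linr).
- by apply: bilinear2P => *; rewrite ?L_lin (nmul_lin, nmul_linr).
by rewrite RE LE !tens_mulE !mactrl.
Qed.

Definition mtens : multiplier (V ⊗ W) := Multiplier L_lin R_lin LM RM RL.
End MTens.

Section MSwap.
Variable m : multiplier (V ⊗ W).

Let L (t : W ⊗ V) : W ⊗ V := tswap (mactl m (tswap t)).
Let R (t : W ⊗ V) : W ⊗ V := tswap (mactr m (tswap t)).
Let L_lin : linear L.
Proof. by move=> c s t; rewrite /L tswap_linear mactl_linear tswap_linear. Qed.
Let R_lin : linear R.
Proof. by move=> c s t; rewrite /R tswap_linear mactr_linear tswap_linear. Qed.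
Let LM s t : L (s ** t) = L s ** t.
Proof. by rewrite /L tswapM mactlM tswapM tswapK. Qed.
Let RM s t : R (s ** t) = s ** R t.
Proof. by rewrite /R tswapM mactrM tswapM tswapK. Qed.
Let RL s t : R s ** t = s ** L t.
Proof.
by rewrite /R /L -{1}[t]tswapK -{2}[s]tswapK -!tswapM mactrl.
Qed.

(* the extension of the flip to M(V ⊗ W) -> M(W ⊗ V) *)
Definition mswap : multiplier (W ⊗ V) := Multiplier L_lin R_lin LM RM RL.
End MSwap.
End TensorMultiplier.

Section AlgebraPredicates.
Variable k : fieldType.

Definition nondegenerate_product (A : nalgType k) : Prop := forall a : A,
  ((forall b, a ** b = 0) -> a = 0) /\ ((forall b, b ** a = 0) -> a = 0).

Definition local_units (A : nalgType k) : Prop := forall s : seq A,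
  exists e : A, forall a, a \in s -> e ** a = a /\ a ** e = a.

Definition algebra_hom (A B : nalgType k) (f : A -> B) : Prop :=
  linear f /\ (forall a b, f (a ** b) = f a ** f b).

End AlgebraPredicates.

Section MultiplierHopf.
Variables (k : fieldType) (Q : nalgType k) (Delta : Q -> multiplier (Q ⊗ Q)).

Definition T1 (t : Q ⊗ Q) : Q ⊗ Q :=
  \tsum_(x, y <- t) elt (Delta x ** mtens mone (memb y)).
Definition T2 (t : Q ⊗ Q) : Q ⊗ Q :=
  \tsum_(x, y <- t) elt (mtens (memb x) mone ** Delta y).

(* [tassocV \o tmap id T1 \o tassoc] is id ⊗ T1 on (Q ⊗ Q) ⊗ Q. *)
Definition multiplier_hopf : Prop :=
  [/\ algebra_hom Delta,
      forall x y, inA (Delta x ** mtens mone (memb y)) /\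
                  inA (mtens (memb x) mone ** Delta y),
      tmap T2 id \o (@tassocV _ Q Q Q \o tmap id T1 \o @tassoc _ Q Q Q)
      =1 (@tassocV _ Q Q Q \o tmap id T1 \o @tassoc _ Q Q Q) \o tmap T2 id,
      bijective T1
    & bijective T2].

(* (eps ⊗ id)(Delta(x)(1 ⊗ y)) = xy and (id ⊗ eps)((x ⊗ 1)Delta(y)) = xy *)
Definition is_counit (eps : Q -> k) : Prop :=
  [/\ linear (eps : Q -> k^o),
      forall x y, eps (x ** y) = eps x * eps y,
      forall x y, \tsum_(u, v <- T1 (x ⊗ y)) (eps u *: v) = x ** y
    & forall x y, \tsum_(u, v <- T2 (x ⊗ y)) (eps v *: u) = x ** y].

(* m(S ⊗ id)(Delta(x)(1 ⊗ y)) = eps(x)y and m(id ⊗ S)((x ⊗ 1)Delta(y)) = eps(y)x;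
   the first identity already determines S, as T1 is bijective. *)
Definition is_antipode (S : Q -> Q) : Prop :=
  [/\ linear S,
      forall x y, S (x ** y) = S y ** S x
    & exists2 eps, is_counit eps & forall x y,
        \tsum_(u, v <- T1 (x ⊗ y)) (S u ** v) = eps x *: y /\
        \tsum_(u, v <- T2 (x ⊗ y)) (u ** S v) = eps y *: x].

End MultiplierHopf.

Definition regular_multiplier_hopf (k : fieldType) (Q : nalgType k)
    (Delta : Q -> multiplier (Q ⊗ Q)) : Prop :=
  multiplier_hopf Delta /\ multiplier_hopf (fun x => mswap (Delta x)).

Section BimoduleAlgebra.
Variables (k : fieldType) (Q A : nalgType k) (Delta : Q -> multiplier (Q ⊗ Q)).
Variables (lact : Q -> A -> A) (ract : A -> Q -> A).

(* x |> (a (p |> b)) = (x_1 |> a) (x_2 p |> b), where the sum is taken over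
   Delta(x)(1 ⊗ p); by unitality this covers all products. *)
Definition left_module_algebra : Prop :=
  [/\ bilinear2 lact,
      forall x y a, lact (x ** y) a = lact x (lact y a),
      forall a, exists t : Q ⊗ A, tsum lact t = a
    & forall x p a b, lact x (a ** lact p b) =
        \tsum_(u, v <- T1 Delta (x ⊗ p)) (lact u a ** lact v b)].

(* ((a <| p) b) <| x = (a <| p x_1) (b <| x_2), over (p ⊗ 1)Delta(x) *)
Definition right_module_algebra : Prop :=
  [/\ bilinear2 ract,
      forall a x y, ract a (x ** y) = ract (ract a x) y,
      forall a, exists t : A ⊗ Q, tsum ract t = a
    & forall x p a b, ract (ract a p ** b) x =
        \tsum_(u, v <- T2 Delta (p ⊗ x)) (ract a u ** ract b v)].

Definition bimodule_algebra : Prop :=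
  [/\ left_module_algebra, right_module_algebra
    & forall x a y, ract (lact x a) y = lact x (ract a y)].

End BimoduleAlgebra.

Section BicomoduleAlgebra.
Variables (k : fieldType) (Q B : nalgType k) (Delta : Q -> multiplier (Q ⊗ Q)).
Variables (Gamma : B -> multiplier (Q ⊗ B)) (Upsilon : B -> multiplier (B ⊗ Q)).

Definition Gamma_r (b : B) (x : Q) : Q ⊗ B := elt (Gamma b ** mtens (memb x) mone).
Definition Gamma_l (x : Q) (b : B) : Q ⊗ B := elt (mtens (memb x) mone ** Gamma b).
Definition Upsilon_r (b : B) (x : Q) : B ⊗ Q :=
  elt (Upsilon b ** mtens mone (memb x)).
Definition Upsilon_l (x : Q) (b : B) : B ⊗ Q :=
  elt (mtens mone (memb x) ** Upsilon b).

(* The last clause is (id ⊗ Gamma)Gamma = (Delta ⊗ id)Gamma, covered by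
   multiplying both sides on the right with Delta(p)(1 ⊗ r) ⊗ 1 (as T1 is onto,
   the Delta(p)(1 ⊗ r) span Q ⊗ Q):
     ((Delta ⊗ id)Gamma(b)) (Delta(p)(1 ⊗ r) ⊗ 1)
       = (Delta ⊗ id)(Gamma(b)(p ⊗ 1)) (1 ⊗ r ⊗ 1),
     ((id ⊗ Gamma)Gamma(b)) (x ⊗ y ⊗ 1)
       = (id ⊗ Gamma)(Gamma(b)(x ⊗ 1)) (1 ⊗ y ⊗ 1). *)
Definition left_comodule_algebra : Prop :=
  [/\ injective Gamma, algebra_hom Gamma,
      forall b x, inA (Gamma b ** mtens (memb x) mone) /\
                  inA (mtens (memb x) mone ** Gamma b)
    & forall b p r,
        \tsum_(x, y <- T1 Delta (p ⊗ r)) \tsum_(q, c <- Gamma_r b x)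
          q ⊗ Gamma_r c y
        = tassoc (\tsum_(q, c <- Gamma_r b p) T1 Delta (q ⊗ r) ⊗ c)].

(* (Upsilon ⊗ id)Upsilon = (id ⊗ Delta)Upsilon, multiplied on the right with
   1 ⊗ Delta(p)(1 ⊗ r) *)
Definition right_comodule_algebra : Prop :=
  [/\ injective Upsilon, algebra_hom Upsilon,
      forall b x, inA (Upsilon b ** mtens mone (memb x)) /\
                  inA (mtens mone (memb x) ** Upsilon b)
    & forall b p r,
        tassoc (\tsum_(x, y <- T1 Delta (p ⊗ r)) \tsum_(c, q <- Upsilon_r b y)
          Upsilon_r c x ⊗ q)
        = \tsum_(c, q <- Upsilon_r b p) c ⊗ T1 Delta (q ⊗ r)].

(* (id ⊗ Upsilon)Gamma = (Gamma ⊗ id)Upsilon, multiplied on the right with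
   x ⊗ 1 ⊗ y *)
Definition bicomodule_algebra : Prop :=
  [/\ left_comodule_algebra, right_comodule_algebra
    & forall b x y,
        \tsum_(q, c <- Gamma_r b x) q ⊗ Upsilon_r c y
        = tassoc (\tsum_(c, q <- Upsilon_r b y) Gamma_r c x ⊗ q)].

End BicomoduleAlgebra.

Section Products.
Variables (k : fieldType) (Q A B : nalgType k).
Variables (S Sinv : Q -> Q).
Variables (lact : Q -> A -> A) (ract : A -> Q -> A).
Variables (Gamma : B -> multiplier (Q ⊗ B)) (Upsilon : B -> multiplier (B ⊗ Q)).

Local Notation "x |> a" := (lact x a) (at level 38, right associativity).
Local Notation "a <| x" := (ract a x) (at level 39, left associativity).

(* Elements e, f of Q with e |> a = a and a <| f = a; they exist when Q has local
   units and the actions are unital. *)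
Definition lunit (a : A) : Q := xget 0 [set e | e |> a = a].
Definition runit (a : A) : Q := xget 0 [set f | a <| f = a].

(* (b' a')(b a) = b' b_0 (S^-1(b_-1) |> a' <| b_1) a, covered by
   S^-1(b_-1) |> a' = S^-1(S(e) b_-1) |> a' and a' <| b_1 = a' <| f b_1 with
   e = lunit a' and f = runit a'. *)
Definition star_r (s t : B ⊗ A) : B ⊗ A :=
  \tsum_(b', a' <- s) \tsum_(b, a <- t)
    \tsum_(b0, y <- Upsilon_l Upsilon (runit a') b)
      \tsum_(z, b00 <- Gamma_l Gamma (S (lunit a')) b0)
        (b' ** b00) ⊗ ((Sinv z |> a' <| y) ** a).

(* (a b)(a' b') = a (b_-1 |> a' <| S^-1(b_1)) b_0 b', covered by
   b_-1 |> a' = b_-1 e |> a' and a' <| S^-1(b_1) = a' <| S^-1(b_1 S(f)) *)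
Definition star_l (s t : A ⊗ B) : A ⊗ B :=
  \tsum_(a, b <- s) \tsum_(a', b' <- t)
    \tsum_(x, b0 <- Gamma_r Gamma b (lunit a'))
      \tsum_(b00, z <- Upsilon_r Upsilon b0 (S (runit a')))
        (a ** (x |> a' <| Sinv z)) ⊗ (b00 ** b').

(* (b' a')(b a) = b'_0 b_0 (a' <| b_1) (b'_-1 |> a) *)
Definition diamond_r (s t : B ⊗ A) : B ⊗ A :=
  \tsum_(b', a' <- s) \tsum_(b, a <- t)
    \tsum_(x, b'0 <- Gamma_r Gamma b' (lunit a))
      \tsum_(b0, y <- Upsilon_l Upsilon (runit a') b)
        (b'0 ** b0) ⊗ ((a' <| y) ** (x |> a)).

(* (a b)(a' b') = (a <| b'_1) (b_-1 |> a') b_0 b'_0 *)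
Definition diamond_l (s t : A ⊗ B) : A ⊗ B :=
  \tsum_(a, b <- s) \tsum_(a', b' <- t)
    \tsum_(x, b0 <- Gamma_r Gamma b (lunit a'))
      \tsum_(b'0, y <- Upsilon_l Upsilon (runit a) b')
        ((a <| y) ** (x |> a')) ⊗ (b0 ** b'0).

End Products.

Definition algebra_iso (k : fieldType) (V W : lmodType k)
    (mu : V -> V -> V) (nu : W -> W -> W) (f : V -> W) : Prop :=
  [/\ linear f, bijective f & forall x y, f (mu x y) = nu (f x) (f y)].

Section MultiplierFacts.
Variable k : fieldType.

Lemma mult_mulE (A : nalgType k) (m n : multiplier A) a :
  (mactl (m ** n) a = mactl m (mactl n a)) *
  (mactr (m ** n) a = mactr n (mactr m a)).
Proof. by []. Qed.

Lemma memb_linear (A : nalgType k) : linear (@memb k A).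
Proof.
by move=> c a b; apply: mult_ext => x /=; rewrite ?nmul_lin ?nmul_linr.
Qed.

Lemma membMl (A : nalgType k) m (a : A) : m ** memb a = memb (mactl m a).
Proof. by apply: mult_ext => x /=; rewrite ?mactlM ?mactrl. Qed.

Lemma membMr (A : nalgType k) m (a : A) : memb a ** m = memb (mactr m a).
Proof. by apply: mult_ext => x /=; rewrite ?mactrM ?mactrl. Qed.

Lemma memb_inj (A : nalgType k) : nondegenerate_product A -> injective (@memb k A).
Proof.
move=> nd a b ab; apply/eqP; rewrite -subr_eq0; apply/eqP.
apply: (nd _).1 => x; rewrite nmulDl -scaleN1r nmulZl scaleN1r.
by rewrite -[a ** x]/(mactl (memb a) x) ab /= subrr.
Qed.

Lemma eltP (A : nalgType k) (m : multiplier A) : inA m -> memb (elt m) = m.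
Proof. by case=> a ma; rewrite /elt -(xgetI 0 (P := [set a | m = memb a]) ma). Qed.

Lemma tens_units (V W : nalgType k) : local_units V -> local_units W ->
  forall t : V ⊗ W, exists (e : V) (f : W),
    (e ⊗ f) ** t = t /\ t ** (e ⊗ f) = t.
Proof.
move=> uV uW t.
have [e he] := uV (map fst (repr t)); have [f hf] := uW (map snd (repr t)).
exists e, f; split.
  rewrite -[in RHS](tsum_tpure t) -[in LHS](tsum_tpure t).
  rewrite lin_tsum => [|c u v]; last exact: nmul_linr.
  rewrite /tsum; apply: eq_big_seq => p pt; rewrite tens_mulE.
  by rewrite (he _ (map_f _ pt)).1 (hf _ (map_f _ pt)).1.
rewrite -[in RHS](tsum_tpure t) -[in LHS](tsum_tpure t).
rewrite (lin_tsum (g := fun x => x ** (e ⊗ f))) => [|c u v]; last exact: nmul_lin.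
rewrite /tsum; apply: eq_big_seq => p pt; rewrite tens_mulE.
by rewrite (he _ (map_f _ pt)).2 (hf _ (map_f _ pt)).2.
Qed.

Lemma tens_nondegenerate (V W : nalgType k) : local_units V -> local_units W ->
  nondegenerate_product (tensor V W).
Proof.
move=> uV uW t; have [e [f [h1 h2]]] := tens_units uV uW t.
by split=> h; [rewrite -h2 h|rewrite -h1 h].
Qed.

Lemma mtensE (V W : nalgType k) (m : multiplier V) (n : multiplier W) v w :
  (mactl (mtens m n) (v ⊗ w) = mactl m v ⊗ mactl n w) *
  (mactr (mtens m n) (v ⊗ w) = mactr m v ⊗ mactr n w).
Proof.
by split; apply: tmapE; (apply: mactl_linear || apply: mactr_linear).
Qed.

End MultiplierFacts.

Section TensorFacts.
Variable k : fieldType.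
Implicit Types U V W Z : lmodType k.

Lemma tsum_tmap V V' W W' Z (f : V -> V') (g : W -> W') (F : V' -> W' -> Z) t :
  bilinear2 F -> tsum F (tmap f g t) = \tsum_(v, w <- t) F (f v) (g w).
Proof.
move=> bF; rewrite /tmap lin_tsum; last exact: tsum_linear.
by apply: eq_tsum => v w; rewrite tsumE.
Qed.

Lemma tsum_tswap V W Z (F : V -> W -> Z) (t : W ⊗ V) :
  bilinear2 F -> tsum F (tswap t) = \tsum_(w, v <- t) F v w.
Proof.
move=> bF; rewrite /tswap lin_tsum; last exact: tsum_linear.
by apply: eq_tsum => v w; rewrite tsumE.
Qed.

Lemma bilinear2_tsum V W V' W' Z (t : V' ⊗ W') (F : V' -> W' -> V -> W -> Z) :
  (forall v' w', bilinear2 (F v' w')) ->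
  bilinear2 (fun v w => \tsum_(v', w' <- t) F v' w' v w).
Proof.
move=> bF; apply: bilinear2P => *; rewrite -tsum_funD; apply: eq_tsum => v' w'.
  by rewrite (bilDl (bF v' w')).
by rewrite (bilDr (bF v' w')).
Qed.

Lemma bilinear2_comp V W V' W' Z (F : V' -> W' -> Z) (f : V -> V') (g : W -> W') :
  bilinear2 F -> linear f -> linear g -> bilinear2 (fun v w => F (f v) (g w)).
Proof.
by move=> bF lf lg; apply: bilinear2P => *; rewrite ?lf ?lg (bilDl bF, bilDr bF).
Qed.

Lemma bilinear2_lin V W Z Z' (F : V -> W -> Z) (g : Z -> Z') :
  bilinear2 F -> linear g -> bilinear2 (fun v w => g (F v w)).
Proof.
by move=> bF lg; apply: bilinear2P => *; rewrite (bilDl bF, bilDr bF) lg.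
Qed.

Lemma bilinear2_sym V W Z (F : V -> W -> Z) :
  bilinear2 F -> bilinear2 (fun w v => F v w).
Proof. by move=> bF; apply: bilinear2P => *; rewrite (bilDl bF, bilDr bF). Qed.

End TensorFacts.

(* [twist F act unit a b] is the sum of the b_0 ⊗ (a b_1), where a is acted upon by
   [act] and [F q b] is the sum of the b_0 ⊗ q b_1. *)
Section Twist.
Variables (k : fieldType) (Q A B : lmodType k).
Variables (qm : Q -> Q -> Q) (act : A -> Q -> A).
Variables (F : Q -> B -> B ⊗ Q) (G : Q -> B -> B ⊗ Q).
Hypothesis qm_bilinear : bilinear2 qm.
Hypothesis act_bilinear : bilinear2 act.
Hypothesis actA : forall a x y, act a (qm x y) = act (act a x) y.
Hypothesis right_units :
  forall s : seq Q, exists g, forall x, x \in s -> qm x g = x.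
Hypothesis G_linear : forall g, linear (G g).
Hypothesis FG : forall q g b, tmap id (qm^~ g) (F q b) = tmap id (qm q) (G g b).
Variable unit : A -> Q.
Hypothesis unitP : forall a, act a (unit a) = a.

Definition twist (a : A) (b : B) : B ⊗ A :=
  \tsum_(b0, y <- F (unit a) b) b0 ⊗ act a y.

Let body_bilinear c : bilinear2 (fun b0 y => (b0 : B) ⊗ act c y).
Proof.
by apply: bilinear2P => *; rewrite ?(bilDr act_bilinear) (tpureDl, tpureDr).
Qed.

Let absorb (s : seq (Q * B)) : exists g, forall q b, (q, b) \in s ->
  forall c, \tsum_(b0, y <- F q b) b0 ⊗ act c y
            = \tsum_(b0, y <- G g b) b0 ⊗ act (act c q) y.
Proof.
have [g hg] := right_units (flatten [seq map snd (repr (F p.1 p.2)) | p <- s]).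
exists g => q b qbs c.
have -> : F q b = tmap id (qm^~ g) (F q b).
  rewrite -[LHS]tsum_tpure /tmap; apply: eq_big_seq => p pF.
  rewrite hg //; apply/flattenP; exists (map snd (repr (F q b))).
    by apply/mapP; exists (q, b).
  exact: map_f.
rewrite FG tsum_tmap //; apply: eq_tsum => b0 y.
by rewrite actA.
Qed.

Lemma twistE c q b :
  twist (act c q) b = \tsum_(b0, y <- F q b) b0 ⊗ act c y.
Proof.
rewrite /twist; set a := act c q.
have [g hg] := absorb [:: (q, b); (unit a, b)].
by rewrite !hg ?unitP // !inE eqxx ?orbT.
Qed.

Lemma twist_bilinear : bilinear2 twist.
Proof.
apply: bilinear2P => [c a a' b|c a b b'].
  have [g hg] := absorb [:: (unit (c *: a + a'), b); (unit a, b); (unit a', b)].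
  rewrite /twist !hg ?inE ?eqxx ?orbT // !unitP -tsum_funD.
  by apply: eq_tsum => b0 y; rewrite (bilDl act_bilinear) tpureDr.
have [g hg] := absorb [:: (unit a, c *: b + b'); (unit a, b); (unit a, b')].
rewrite /twist !hg ?inE ?eqxx ?orbT // G_linear.
by rewrite tsum_linear // unitP.
Qed.
End Twist.

Section AntipodeUnique.
Variables (k : fieldType) (Q : nalgType k) (Delta : Q -> multiplier (Q ⊗ Q)).
Hypotheses (Q_units : local_units Q) (Q_hopf : multiplier_hopf Delta).

Lemma T1_linear : linear (T1 Delta).
Proof.
have [[Dl _] Din _ _ _] := Q_hopf; apply: tsum_linear.
have inj := memb_inj (tens_nondegenerate Q_units Q_units).
have eP x y := eltP (Din x y).1.
apply: bilinear2P => *; apply: inj; rewrite [RHS]memb_linear !eP.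
  by rewrite Dl nmul_lin.
rewrite -nmul_linr; congr (_ ** _); apply: mult_ext => t /=.
  rewrite /tmap -tsum_funD; apply: eq_tsum => v w.
  by rewrite nmul_lin tpureDr.
rewrite /tmap -tsum_funD; apply: eq_tsum => v w.
by rewrite nmul_linr tpureDr.
Qed.

Let T1_det (Z : lmodType k) (f g : Q -> Q -> Z) : bilinear2 f -> bilinear2 g ->
  (forall x y, tsum f (T1 Delta (x ⊗ y)) = tsum g (T1 Delta (x ⊗ y))) ->
  forall u v, f u v = g u v.
Proof.
move=> bf bg fg u v; rewrite -(tsumE u v bf) -(tsumE u v bg).
have [_ _ _ [T T1K TK] _] := Q_hopf; rewrite -(TK (u ⊗ v)).
move: (T (u ⊗ v)); apply: tens_lin_ext => // c s t.
  by rewrite T1_linear tsum_linear.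
by rewrite T1_linear tsum_linear.
Qed.

Lemma counit_unique eps eps' :
  is_counit Delta eps -> is_counit Delta eps' -> forall u v : Q, eps u *: v = eps' u *: v.
Proof.
have bil (e : Q -> k) : linear (e : Q -> k^o) -> bilinear2 (fun u v : Q => e u *: v).
  move=> el; apply: bilinear2P => [c v v' w|c v w w'].
    by rewrite (el c) scalerDl scalerA.
  by rewrite scalerDr !scalerA mulrC.
case=> el _ e1 _ [el' _ e1' _]; apply: T1_det; try exact: bil.
by move=> x y; rewrite e1 e1'.
Qed.

Lemma antipode_unique S S' : is_antipode Delta S -> is_antipode Delta S' -> S =1 S'.
Proof.
have bil (f : Q -> Q) : linear f -> bilinear2 (fun u v : Q => f u ** v).
  by move=> lf; apply: bilinear2P => *; rewrite ?lf (nmul_lin, nmul_linr).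
case=> Sl _ [e ce eS] [Sl' _ [e' ce' eS']] x.
have SS' : forall u v, S u ** v = S' u ** v.
  apply: T1_det; try exact: bil.
  by move=> u v; rewrite (eS _ _).1 (eS' _ _).1; apply: counit_unique.
have [g hg] := Q_units [:: S x; S' x].
have /hg[_ <-] : S x \in [:: S x; S' x] by rewrite !inE eqxx.
have /hg[_ <-] : S' x \in [:: S x; S' x] by rewrite !inE eqxx orbT.
exact: SS'.
Qed.

End AntipodeUnique.

Section Quadrilinear.
Variables (k : fieldType) (V W V' W' Z : lmodType k).
Variable f : V -> W -> V' -> W' -> Z.
Hypothesis fl : forall v' w', bilinear2 (fun v w => f v w v' w').
Hypothesis fr : forall v w, bilinear2 (f v w).

Definition tsum2 (s : V ⊗ W) (t : V' ⊗ W') : Z :=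
  \tsum_(v, w <- s) \tsum_(v', w' <- t) f v w v' w'.

Lemma tsum2_bilinear : bilinear2 tsum2.
Proof.
apply: bilinear2P => [c s s' t|c s t t'].
  by apply: tsum_linear; apply: bilinear2_tsum.
by rewrite /tsum2 -tsum_funD; apply: eq_tsum => v w; rewrite tsum_linear.
Qed.

Lemma tsum2E v w v' w' : tsum2 (v ⊗ w) (v' ⊗ w') = f v w v' w'.
Proof.
rewrite /tsum2 tsumE; first by rewrite tsumE.
exact: (bilinear2_tsum (v' ⊗ w') (fun v' w' => fl v' w')).
Qed.
End Quadrilinear.

(* The products are bilinear, and given by the covered formulas of [star_rE] and
   its analogues for every expression p |> c <| q of the covering element, so that
   they do not depend on the choices of [lunit] and [runit]. *)
Section WellDefined.
Variables (k : fieldType) (Q A B : nalgType k).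
Hypotheses (Q_units : local_units Q) (B_units : local_units B).
Variable Delta : Q -> multiplier (Q ⊗ Q).
Variables (S Sinv : Q -> Q).
Hypotheses (S_antipode : is_antipode Delta S).
Hypotheses (SK : cancel S Sinv) (SinvK : cancel Sinv S).
Variables (lact : Q -> A -> A) (ract : A -> Q -> A).
Hypothesis A_bimod : bimodule_algebra Delta lact ract.
Variables (Gamma : B -> multiplier (Q ⊗ B)) (Upsilon : B -> multiplier (B ⊗ Q)).
Hypothesis B_bicomod : bicomodule_algebra Delta Gamma Upsilon.

Local Notation "x |> a" := (lact x a) (at level 38, right associativity).
Local Notation "a <| x" := (ract a x) (at level 39, left associativity).
Local Notation lunit := (lunit lact).
Local Notation runit := (runit ract).
Local Notation Gamma_r := (Gamma_r Gamma).
Local Notation Gamma_l := (Gamma_l Gamma).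
Local Notation Upsilon_r := (Upsilon_r Upsilon).
Local Notation Upsilon_l := (Upsilon_l Upsilon).

Let lact_bil : bilinear2 lact. Proof. by have [[]] := A_bimod. Qed.
Let ract_bil : bilinear2 ract. Proof. by have [_ []] := A_bimod. Qed.
Let lactA x y a : (x ** y) |> a = x |> y |> a.
Proof. by have [[_ ->]] := A_bimod. Qed.
Let ractA a x y : a <| (x ** y) = a <| x <| y.
Proof. by have [_ [_ ->]] := A_bimod. Qed.
Let lractC x a y : (x |> a) <| y = x |> (a <| y).
Proof. by have [] := A_bimod. Qed.

Lemma lunitP a : lunit a |> a = a.
Proof.
apply: (xgetPex 0 (P := [set e | e |> a = a])).
have [[_ _ /(_ a)[t <-] _] _ _] := A_bimod.
have [e he] := Q_units (map fst (repr t)); exists e => /=.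
rewrite lin_tsum; last exact: lact_bil.2.
by apply: eq_big_seq => p pt; rewrite -lactA (he _ (map_f _ pt)).1.
Qed.

Lemma runitP a : a <| runit a = a.
Proof.
apply: (xgetPex 0 (P := [set f | a <| f = a])).
have [_ [_ _ /(_ a)[t <-] _] _] := A_bimod.
have [f hf] := Q_units (map snd (repr t)); exists f => /=.
rewrite (lin_tsum (g := ract^~ f)); last exact: ract_bil.1.
by apply: eq_big_seq => p pt; rewrite -ractA (hf _ (map_f _ pt)).2.
Qed.

Let Sinv_linear : linear Sinv.
Proof.
have [Sl _ _] := S_antipode.
by move=> c x y; apply: (can_inj SK); rewrite SinvK Sl !SinvK.
Qed.
Let SinvM x y : Sinv (x ** y) = Sinv y ** Sinv x.
Proof.
have [_ SM _] := S_antipode.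
by apply: (can_inj SK); rewrite SinvK SM !SinvK.
Qed.

Let QB_inj : injective (@memb k (tensor Q B)).
Proof. exact/memb_inj/tens_nondegenerate. Qed.
Let BQ_inj : injective (@memb k (tensor B Q)).
Proof. exact/memb_inj/tens_nondegenerate. Qed.

Let Gamma_rP b x : memb (Gamma_r b x) = Gamma b ** mtens (memb x) mone.
Proof. by have [[_ _ /(_ b x)[h _] _] _ _] := B_bicomod; apply: eltP. Qed.
Let Gamma_lP x b : memb (Gamma_l x b) = mtens (memb x) mone ** Gamma b.
Proof. by have [[_ _ /(_ b x)[_ h] _] _ _] := B_bicomod; apply: eltP. Qed.
Let Upsilon_rP b x : memb (Upsilon_r b x) = Upsilon b ** mtens mone (memb x).
Proof. by have [_ [_ _ /(_ b x)[h _] _] _] := B_bicomod; apply: eltP. Qed.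
Let Upsilon_lP x b : memb (Upsilon_l x b) = mtens mone (memb x) ** Upsilon b.
Proof. by have [_ [_ _ /(_ b x)[_ h] _] _] := B_bicomod; apply: eltP. Qed.

Let Gamma_linear : linear Gamma.
Proof. by have [[_ []]] := B_bicomod. Qed.
Let Upsilon_linear : linear Upsilon.
Proof. by have [_ [_ []]] := B_bicomod. Qed.

Let Gamma_r_linear x : linear (Gamma_r^~ x).
Proof.
move=> c b b'; apply: QB_inj; rewrite memb_linear !Gamma_rP.
by rewrite Gamma_linear nmul_lin.
Qed.
Let Gamma_l_linear x : linear (Gamma_l x).
Proof.
move=> c b b'; apply: QB_inj; rewrite memb_linear !Gamma_lP.
by rewrite Gamma_linear nmul_linr.
Qed.
Let Upsilon_r_linear x : linear (Upsilon_r^~ x).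
Proof.
move=> c b b'; apply: BQ_inj; rewrite memb_linear !Upsilon_rP.
by rewrite Upsilon_linear nmul_lin.
Qed.
Let Upsilon_l_linear x : linear (Upsilon_l x).
Proof.
move=> c b b'; apply: BQ_inj; rewrite memb_linear !Upsilon_lP.
by rewrite Upsilon_linear nmul_linr.
Qed.

Let Upsilon_lr q g b :
  tmap id (nmul^~ g) (Upsilon_l q b) = tmap id (nmul q) (Upsilon_r b g).
Proof.
apply: BQ_inj.
rewrite -[tmap id _ _]/(mactr (mtens mone (memb g)) (Upsilon_l q b)) -membMr.
rewrite -[tmap id _ _]/(mactl (mtens mone (memb q)) (Upsilon_r b g)) -membMl.
by rewrite Upsilon_lP Upsilon_rP nmulA.
Qed.

Let Gamma_lr q g b :
  tmap (nmul^~ g) id (Gamma_l q b) = tmap (nmul q) id (Gamma_r b g).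
Proof.
apply: QB_inj.
rewrite -[tmap _ id _]/(mactr (mtens (memb g) mone) (Gamma_l q b)) -membMr.
rewrite -[tmap _ id _]/(mactl (mtens (memb q) mone) (Gamma_r b g)) -membMl.
by rewrite Gamma_lP Gamma_rP nmulA.
Qed.

Let tmap_tswap (f : Q -> Q) (t : Q ⊗ B) : linear f ->
  tmap id f (tswap t) = tswap (tmap f id t).
Proof.
move=> lf; rewrite {1}/tmap tsum_tswap; last exact: tmap_bilinear.
rewrite [RHS]/tswap tsum_tmap //; exact: tswap_bilinear.
Qed.

Let units_r (s : seq Q) : exists g, forall x, x \in s -> x ** g = x.
Proof. by have [g hg] := Q_units s; exists g => x /hg[]. Qed.
Let units_l (s : seq Q) : exists g, forall x, x \in s -> g ** x = x.
Proof. by have [g hg] := Q_units s; exists g => x /hg[]. Qed.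

Let qmul_bil : bilinear2 (@nmul k Q) := @nmul_bilinear k Q.
Let qmulop_bil : bilinear2 (fun x y : Q => y ** x) := bilinear2_sym qmul_bil.

(* b_0 ⊗ (a <| b_1), b_0 ⊗ (b_-1 |> a), b_0 ⊗ (S^-1(b_-1) |> a), and
   b_0 ⊗ (a <| S^-1(b_1)) *)
Let rho := twist ract Upsilon_l runit.
Let lam := twist (fun a x => x |> a) (fun q b => tswap (Gamma_r b q)) lunit.
Let sig := twist (fun a z => Sinv z |> a) (fun q b => tswap (Gamma_l q b))
  (fun a => S (lunit a)).
Let tau := twist (fun a z => a <| Sinv z) (fun q b => Upsilon_r b q)
  (fun a => S (runit a)).

Let swap_linear (F : B -> Q ⊗ B) : linear F -> linear (fun b => tswap (F b)).
Proof. by move=> lF c b b'; rewrite lF tswap_linear. Qed.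

Let act_lam_bil : bilinear2 (fun a x => x |> a).
Proof. exact: bilinear2_sym lact_bil. Qed.
Let act_sig_bil : bilinear2 (fun a z => Sinv z |> a).
Proof. exact: (bilinear2_sym (bilinear2_comp (g := id) lact_bil Sinv_linear _)). Qed.
Let act_tau_bil : bilinear2 (fun a z => a <| Sinv z).
Proof. exact: (bilinear2_comp (f := id) ract_bil _ Sinv_linear). Qed.

Let nmul_l_linear (x : Q) : linear (nmul x).
Proof. by move=> c y z; rewrite nmul_linr. Qed.
Let nmul_r_linear (x : Q) : linear (nmul^~ x).
Proof. by move=> c y z; rewrite nmul_lin. Qed.

Let lam_FG q g b : tmap id (fun x : Q => g ** x) (tswap (Gamma_r b q))
  = tmap id (fun x : Q => x ** q) (tswap (Gamma_l g b)).
Proof. by rewrite !tmap_tswap // Gamma_lr. Qed.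
Let sig_FG q g b : tmap id (nmul^~ g) (tswap (Gamma_l q b))
  = tmap id (nmul q) (tswap (Gamma_r b g)).
Proof. by rewrite !tmap_tswap // Gamma_lr. Qed.

Let rho_bil : bilinear2 rho.
Proof.
by apply: (twist_bilinear (qm := @nmul k Q) (G := fun g b => Upsilon_r b g))
  => //; exact: runitP.
Qed.
Let rhoE c q b : rho (c <| q) b = \tsum_(b0, y <- Upsilon_l q b) b0 ⊗ (c <| y).
Proof.
by apply: (twistE (qm := @nmul k Q) (G := fun g b => Upsilon_r b g))
  => //; exact: runitP.
Qed.

Let lam_bil : bilinear2 lam.
Proof.
apply: (twist_bilinear (qm := fun x y : Q => y ** x)
  (G := fun g b => tswap (Gamma_l g b))) => //.
- by move=> g; apply: swap_linear.
- exact: lunitP.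
Qed.
Let lamE c q b : lam (q |> c) b = \tsum_(x, b0 <- Gamma_r b q) b0 ⊗ (x |> c).
Proof.
rewrite /lam (twistE (act := fun a x => x |> a) (qm := fun x y : Q => y ** x)
  (G := fun g b => tswap (Gamma_l g b))) //; last by exact: lunitP.
  rewrite tsum_tswap //; apply: bilinear2P => *; first by rewrite tpureDl.
  by rewrite (bilDl lact_bil) tpureDr.
Qed.

Let sig_bil : bilinear2 sig.
Proof.
apply: (twist_bilinear (qm := @nmul k Q)
  (G := fun g b => tswap (Gamma_r b g))) => //.
- by move=> a x y; rewrite SinvM lactA.
- by move=> g; apply: swap_linear.
- by move=> a; rewrite SK lunitP.
Qed.
Let sigE c q b :
  sig (q |> c) b = \tsum_(z, b0 <- Gamma_l (S q) b) b0 ⊗ (Sinv z |> c).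
Proof.
rewrite -{1}[q]SK.
rewrite /sig (twistE (act := fun a z => Sinv z |> a) (qm := @nmul k Q)
  (G := fun g b => tswap (Gamma_r b g))) //.
- by rewrite tsum_tswap //; apply: bilinear2P => *;
    rewrite ?(bilDr act_sig_bil) (tpureDl, tpureDr).
- by move=> a x y; rewrite SinvM lactA.
- by move=> a; rewrite SK lunitP.
Qed.

Let tau_bil : bilinear2 tau.
Proof.
apply: (twist_bilinear (qm := fun x y : Q => y ** x) (G := Upsilon_l)) => //.
- by move=> a x y; rewrite SinvM ractA.
- by move=> a; rewrite SK runitP.
Qed.
Let tauE c q b :
  tau (c <| q) b = \tsum_(b0, z <- Upsilon_r b (S q)) b0 ⊗ (c <| Sinv z).
Proof.
rewrite -{1}[q]SK.
rewrite /tau (twistE (act := fun a z => a <| Sinv z)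
  (qm := fun x y : Q => y ** x) (G := Upsilon_l)) //.
- by move=> a x y; rewrite SinvM ractA.
- by move=> a; rewrite SK runitP.
Qed.

Let mulBA := tsum2 (fun u' c u d => (u' ** u : B) ⊗ (d ** c : A)).
Let mulAB := tsum2 (fun u c u' d => (d ** c : A) ⊗ (u ** u' : B)).
Let mulBA_l u d : bilinear2 (fun u' c => (u' ** u : B) ⊗ (d ** c : A)).
Proof.
by apply: bilinear2P => *; rewrite (nmul_lin, nmul_linr) (tpureDl, tpureDr).
Qed.
Let mulBA_r u' c : bilinear2 (fun u d => (u' ** u : B) ⊗ (d ** c : A)).
Proof.
by apply: bilinear2P => *; rewrite (nmul_lin, nmul_linr) (tpureDl, tpureDr).
Qed.
Let mulAB_l u' d : bilinear2 (fun u c => (d ** c : A) ⊗ (u ** u' : B)).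
Proof.
by apply: bilinear2P => *; rewrite (nmul_lin, nmul_linr) (tpureDl, tpureDr).
Qed.
Let mulAB_r u c : bilinear2 (fun u' d => (d ** c : A) ⊗ (u ** u' : B)).
Proof.
by apply: bilinear2P => *; rewrite (nmul_lin, nmul_linr) (tpureDl, tpureDr).
Qed.
Let mulBA_bil : bilinear2 mulBA. Proof. exact: tsum2_bilinear. Qed.
Let mulAB_bil : bilinear2 mulAB. Proof. exact: tsum2_bilinear. Qed.

Let diamond_r_core b' p c d q b :
  mulBA (lam (p |> c) b') (rho (d <| q) b)
  = \tsum_(x, b'0 <- Gamma_r b' p) \tsum_(b0, y <- Upsilon_l q b)
      (b'0 ** b0) ⊗ ((d <| y) ** (x |> c)).
Proof.
rewrite lamE rhoE (lin_tsum (g := mulBA^~ _)); last exact: mulBA_bil.1.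
apply: eq_tsum => x b'0; rewrite lin_tsum; last exact: mulBA_bil.2.
by apply: eq_tsum => b0 y; rewrite /mulBA tsum2E.
Qed.

Let diamond_l_core b p c d q b' :
  mulAB (lam (p |> c) b) (rho (d <| q) b')
  = \tsum_(x, b0 <- Gamma_r b p) \tsum_(b'0, y <- Upsilon_l q b')
      ((d <| y) ** (x |> c)) ⊗ (b0 ** b'0).
Proof.
rewrite lamE rhoE (lin_tsum (g := mulAB^~ _)); last exact: mulAB_bil.1.
apply: eq_tsum => x b'0; rewrite lin_tsum; last exact: mulAB_bil.2.
by apply: eq_tsum => b0 y; rewrite /mulAB tsum2E.
Qed.

Let star_r_fun b' a' b a := \tsum_(b0, c <- rho a' b)
  \tsum_(b00, d <- sig c b0) (b' ** b00 : B) ⊗ (d ** a : A).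
Let star_l_fun a b a' b' := \tsum_(b0, c <- lam a' b)
  \tsum_(b00, d <- tau c b0) (a ** d : A) ⊗ (b00 ** b' : B).

Let star_r_b2 b' a : bilinear2 (fun b00 d => (b' ** b00 : B) ⊗ (d ** a : A)).
Proof.
by apply: bilinear2P => *; rewrite (nmul_lin, nmul_linr) (tpureDl, tpureDr).
Qed.
Let star_l_b2 b' a : bilinear2 (fun b00 d => (a ** d : A) ⊗ (b00 ** b' : B)).
Proof.
by apply: bilinear2P => *; rewrite (nmul_lin, nmul_linr) (tpureDl, tpureDr).
Qed.
Let star_r_b1 b' a : bilinear2 (fun b0 c =>
  \tsum_(b00, d <- sig c b0) (b' ** b00 : B) ⊗ (d ** a : A)).
Proof.
apply: (bilinear2_lin (F := fun b0 c => sig c b0)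
  (g := tsum (fun b00 d => (b' ** b00 : B) ⊗ (d ** a : A)))).
- exact: bilinear2_sym.
- exact: tsum_linear.
Qed.
Let star_l_b1 b' a : bilinear2 (fun b0 c =>
  \tsum_(b00, d <- tau c b0) (a ** d : A) ⊗ (b00 ** b' : B)).
Proof.
apply: (bilinear2_lin (F := fun b0 c => tau c b0)
  (g := tsum (fun b00 d => (a ** d : A) ⊗ (b00 ** b' : B)))).
- exact: bilinear2_sym.
- exact: tsum_linear.
Qed.

Let star_r_core b' p c q b a :
  star_r_fun b' ((p |> c) <| q) b a
  = \tsum_(b0, y <- Upsilon_l q b) \tsum_(z, b00 <- Gamma_l (S p) b0)
      (b' ** b00) ⊗ ((Sinv z |> c <| y) ** a).
Proof.
rewrite /star_r_fun rhoE lin_tsum; last exact: tsum_linear.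
apply: eq_tsum => b0 y; rewrite tsumE // lractC sigE lin_tsum.
  by apply: eq_tsum => z b00; rewrite tsumE // lractC.
exact: tsum_linear.
Qed.

Let star_l_core a b p c q b' :
  star_l_fun a b ((p |> c) <| q) b'
  = \tsum_(x, b0 <- Gamma_r b p) \tsum_(b00, z <- Upsilon_r b0 (S q))
      (a ** (x |> c <| Sinv z)) ⊗ (b00 ** b').
Proof.
rewrite /star_l_fun lractC lamE lin_tsum; last exact: tsum_linear.
apply: eq_tsum => x b0; rewrite tsumE // -lractC tauE lin_tsum.
  by apply: eq_tsum => b00 z; rewrite tsumE.
exact: tsum_linear.
Qed.

Let diamond_rT : diamond_r lact ract Gamma Upsilon
  = tsum2 (fun b' a' b a => mulBA (lam a b') (rho a' b)).
Proof.
apply/funext => s; apply/funext => t; apply: eq_tsum => b' a'.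
apply: eq_tsum => b a; rewrite -diamond_r_core.
by rewrite lunitP runitP.
Qed.
Let diamond_lT : diamond_l lact ract Gamma Upsilon
  = tsum2 (fun a b a' b' => mulAB (lam a' b) (rho a b')).
Proof.
apply/funext => s; apply/funext => t; apply: eq_tsum => a b.
apply: eq_tsum => a' b'; rewrite -diamond_l_core.
by rewrite lunitP runitP.
Qed.
Let star_rT : star_r S Sinv lact ract Gamma Upsilon = tsum2 star_r_fun.
Proof.
apply/funext => s; apply/funext => t; apply: eq_tsum => b' a'.
apply: eq_tsum => b a; rewrite -star_r_core.
by rewrite lunitP runitP.
Qed.
Let star_lT : star_l S Sinv lact ract Gamma Upsilon = tsum2 star_l_fun.
Proof.
apply/funext => s; apply/funext => t; apply: eq_tsum => a b.
apply: eq_tsum => a' b'; rewrite -star_l_core.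
by rewrite lunitP runitP.
Qed.

Let diamond_r_fl b a : bilinear2 (fun b' a' => mulBA (lam a b') (rho a' b)).
Proof.
by apply: bilinear2P => *; rewrite (bilDr lam_bil, bilDl rho_bil)
  (bilDl mulBA_bil, bilDr mulBA_bil).
Qed.
Let diamond_r_fr b' a' : bilinear2 (fun b a => mulBA (lam a b') (rho a' b)).
Proof.
by apply: bilinear2P => *; rewrite (bilDl lam_bil, bilDr rho_bil)
  (bilDl mulBA_bil, bilDr mulBA_bil).
Qed.
Let diamond_l_fl a' b' : bilinear2 (fun a b => mulAB (lam a' b) (rho a b')).
Proof.
by apply: bilinear2P => *; rewrite (bilDr lam_bil, bilDl rho_bil)
  (bilDl mulAB_bil, bilDr mulAB_bil).
Qed.
Let diamond_l_fr a b : bilinear2 (fun a' b' => mulAB (lam a' b) (rho a b')).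
Proof.
by apply: bilinear2P => *; rewrite (bilDl lam_bil, bilDr rho_bil)
  (bilDl mulAB_bil, bilDr mulAB_bil).
Qed.
Let star_r_fl b a : bilinear2 (fun b' a' => star_r_fun b' a' b a).
Proof.
apply: bilinear2P => *; rewrite /star_r_fun.
  rewrite -tsum_funD; apply: eq_tsum => b0 c0; rewrite -tsum_funD.
  by apply: eq_tsum => b00 d0; rewrite nmul_lin tpureDl.
by rewrite (bilDl rho_bil) tsum_linear.
Qed.
Let star_r_fr b' a' : bilinear2 (star_r_fun b' a').
Proof.
apply: bilinear2P => *; rewrite /star_r_fun.
  by rewrite (bilDr rho_bil) tsum_linear.
rewrite -tsum_funD; apply: eq_tsum => b0 c0; rewrite -tsum_funD.
by apply: eq_tsum => b00 d0; rewrite nmul_linr tpureDr.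
Qed.
Let star_l_fl a' b' : bilinear2 (fun a b => star_l_fun a b a' b').
Proof.
apply: bilinear2P => *; rewrite /star_l_fun.
  rewrite -tsum_funD; apply: eq_tsum => b0 c0; rewrite -tsum_funD.
  by apply: eq_tsum => b00 d0; rewrite nmul_lin tpureDl.
by rewrite (bilDr lam_bil) tsum_linear.
Qed.
Let star_l_fr a b : bilinear2 (star_l_fun a b).
Proof.
apply: bilinear2P => *; rewrite /star_l_fun.
  by rewrite (bilDl lam_bil) tsum_linear.
rewrite -tsum_funD; apply: eq_tsum => b0 c0; rewrite -tsum_funD.
by apply: eq_tsum => b00 d0; rewrite nmul_linr tpureDr.
Qed.

Lemma star_r_bilinear : bilinear2 (star_r S Sinv lact ract Gamma Upsilon).
Proof. by rewrite star_rT; apply: tsum2_bilinear. Qed.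
Lemma star_l_bilinear : bilinear2 (star_l S Sinv lact ract Gamma Upsilon).
Proof. by rewrite star_lT; apply: tsum2_bilinear. Qed.
Lemma diamond_r_bilinear : bilinear2 (diamond_r lact ract Gamma Upsilon).
Proof. by rewrite diamond_rT; apply: tsum2_bilinear. Qed.
Lemma diamond_l_bilinear : bilinear2 (diamond_l lact ract Gamma Upsilon).
Proof. by rewrite diamond_lT; apply: tsum2_bilinear. Qed.

Lemma star_rE b' p c q b a :
  star_r S Sinv lact ract Gamma Upsilon (b' ⊗ (p |> c <| q)) (b ⊗ a)
  = \tsum_(b0, y <- Upsilon_l q b) \tsum_(z, b00 <- Gamma_l (S p) b0)
      (b' ** b00) ⊗ ((Sinv z |> c <| y) ** a).
Proof. by rewrite star_rT tsum2E ?star_r_core. Qed.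
Lemma star_lE a b p c q b' :
  star_l S Sinv lact ract Gamma Upsilon (a ⊗ b) ((p |> c <| q) ⊗ b')
  = \tsum_(x, b0 <- Gamma_r b p) \tsum_(b00, z <- Upsilon_r b0 (S q))
      (a ** (x |> c <| Sinv z)) ⊗ (b00 ** b').
Proof. by rewrite star_lT tsum2E ?star_l_core. Qed.
Lemma diamond_rE b' d q b p c :
  diamond_r lact ract Gamma Upsilon (b' ⊗ (d <| q)) (b ⊗ (p |> c))
  = \tsum_(x, b'0 <- Gamma_r b' p) \tsum_(b0, y <- Upsilon_l q b)
      (b'0 ** b0) ⊗ ((d <| y) ** (x |> c)).
Proof. by rewrite diamond_rT tsum2E ?diamond_r_core. Qed.
Lemma diamond_lE d q b p c b' :
  diamond_l lact ract Gamma Upsilon ((d <| q) ⊗ b) ((p |> c) ⊗ b')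
  = \tsum_(x, b0 <- Gamma_r b p) \tsum_(b'0, y <- Upsilon_l q b')
      ((d <| y) ** (x |> c)) ⊗ (b0 ** b'0).
Proof. by rewrite diamond_lT tsum2E ?diamond_l_core. Qed.

End WellDefined.

(* Main.v *)
Require Import Defs.
From mathcomp Require Import all_boot all_order all_algebra.

Set Implicit Arguments.
Unset Strict Implicit.
Unset Printing Implicit Defensive.

Import GRing.Theory.
Local Open Scope ring_scope.

(** In Sweedler notation, b ⋄ a |-> b_0 ⋆ S^-1(b_-1) |> a is an isomorphism
    from B ⋄_r A to B ⋆_r A, with inverse b ⋆ a |-> b_0 ⋄ b_-1 |> a.  In terms of
    the maps from A x B to B ⊗ A
      lam a b = b_0 ⊗ (b_-1 |> a),      sig a b = b_0 ⊗ (S^-1(b_-1) |> a),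
      rho a b = b_0 ⊗ (a <| b_1),       tau a b = b_0 ⊗ (a <| S^-1(b_1)),
    the diamond product applies lam and rho before multiplying, the star product
    applies rho and then sig.  When the inverse map is applied to a star product,
    the compatibility of lam with the products of A and of B brings it next to
    sig, which it cancels; what remains is the diamond product of the images,
    once lam has been moved past rho.  So only five properties of lam, sig and
    rho matter, and [twisted_products_iso] deduces the isomorphism from them.

    Taking opposite products in Q, A and B and the opposite coproduct in Q turns
    right actions and coactions into left ones, exchanges lam with rho and sig
    with tau, and turns the second isomorphism into the first.  For this reason
    all products are explicit functions in [twisted_products_iso] and in the
    theory of covered coactions, which are then applied twice.

    The five properties are the usual Sweedler computations, but every one of
    them has to be covered.  A coaction Gamma of Q on B enters only through
    Gr b x = Gamma(b)(x ⊗ 1) and Gl x b = (x ⊗ 1)Gamma(b), the coproduct only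
    through T1 and T2, and an identity in a tensor product is an identity
    between the sums of an arbitrary multilinear map.  Three points are more than
    bookkeeping.
    - Coassociativity is given with covers on the right, whereas sig and rho need
      it with covers on the left.  One form yields the other
      ([coassociative_transfer]) because T2(p ⊗ q)T1(p' ⊗ r), which is
      (p ⊗ 1)Delta(qp')(1 ⊗ r), depends on q and p' through qp' only.
    - The coaction is counital because it is injective ([coaction_counit_r]).
    - The identities b_-1 S^-1(b_-2) ⊗ b_0 = 1 ⊗ b = S^-1(b_-1) b_-2 ⊗ b_0, which
      make lam and sig inverse to each other, are checked on the range of T2,
      respectively of T1, where covered coassociativity applies; this suffices
      because T1 and T2 are onto ([coaction_Sinv_l], [coaction_Sinv_r]). *)

(** * Calculus of multilinear sums *)

Section MultilinearSums.
Variable k : fieldType.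
Implicit Types U V W X Z : lmodType k.

Definition trilinear U V W Z (F : U -> V -> W -> Z) : Prop :=
  (forall w, bilinear2 (fun u v => F u v w)) /\ (forall u, bilinear2 (F u)).

Lemma linear_id V : linear (fun x : V => x).
Proof. by []. Qed.

Lemma linZ V W (f : V -> W) : linear f -> forall c v, f (c *: v) = c *: f v.
Proof. by move=> lf c v; apply: (scalable_linear lf). Qed.

Lemma linear_after V W Z (f : W -> Z) (g : V -> W) :
  linear f -> linear g -> linear (fun x => f (g x)).
Proof. exact: linear_comp. Qed.

Lemma linear_slot_l U V Z X (f : U -> V -> Z) (g : X -> U) v :
  bilinear2 f -> linear g -> linear (fun x => f (g x) v).
Proof. by move=> bf lg c x y; rewrite lg (bilDl bf). Qed.

Lemma linear_slot_r U V Z X (f : U -> V -> Z) (g : X -> V) u :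
  bilinear2 f -> linear g -> linear (fun x => f u (g x)).
Proof. by move=> bf lg c x y; rewrite lg (bilDr bf). Qed.

Lemma trilinear_slot1 U V W Z X (F : U -> V -> W -> Z) (g : X -> U) v w :
  trilinear F -> linear g -> linear (fun x => F (g x) v w).
Proof. by case=> h _ lg c x y; rewrite lg (bilDl (h w)). Qed.

Lemma trilinear_slot2 U V W Z X (F : U -> V -> W -> Z) u (g : X -> V) w :
  trilinear F -> linear g -> linear (fun x => F u (g x) w).
Proof. by case=> h _ lg c x y; rewrite lg (bilDr (h w)). Qed.

Lemma trilinear_slot3 U V W Z X (F : U -> V -> W -> Z) u v (g : X -> W) :
  trilinear F -> linear g -> linear (fun x => F u v (g x)).
Proof. by case=> _ h lg c x y; rewrite lg (bilDr (h u)). Qed.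

Lemma linear_tsum_arg V W Z X (F : V -> W -> Z) (g : X -> V ⊗ W) :
  bilinear2 F -> linear g -> linear (fun x => tsum F (g x)).
Proof. by move=> bF lg c x y; rewrite lg tsum_linear. Qed.

Lemma linear_tsum_body V W Z X (F : X -> V -> W -> Z) (t : V ⊗ W) :
  (forall v w, linear (fun x => F x v w)) -> linear (fun x => tsum (F x) t).
Proof.
by move=> lF c x y; rewrite -tsum_funD; apply: eq_tsum => v w; rewrite lF.
Qed.

Lemma linear_scale_l V W X (e : V -> k) (g : X -> V) (w : W) :
  linear (e : V -> k^o) -> linear g -> linear (fun x => e (g x) *: w).
Proof. by move=> le lg c x y; rewrite lg (le c) scalerDl scalerA. Qed.

Lemma linear_scale_r V X c (g : X -> V) : linear g -> linear (fun x => c *: g x).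
Proof. by move=> lg d x y; rewrite lg scalerDr !scalerA mulrC. Qed.

Lemma trilinearP U V W Z (F : U -> V -> W -> Z) :
  (forall v w, linear (fun u => F u v w)) ->
  (forall u w, linear (fun v => F u v w)) ->
  (forall u v, linear (fun w => F u v w)) -> trilinear F.
Proof.
by move=> h1 h2 h3; split=> w; split=> v; [exact: h1|exact: h2|exact: h2|exact: h3].
Qed.

Lemma tsum_comp V W V' W' Z (F : V -> W -> Z) (G : V' -> W' -> V ⊗ W) t :
  bilinear2 F -> tsum F (tsum G t) = \tsum_(v, w <- t) tsum F (G v w).
Proof. by move=> bF; apply: lin_tsum; apply: tsum_linear. Qed.

Lemma tsum_exchange V W V' W' Z (F : V -> W -> V' -> W' -> Z)
    (s : V ⊗ W) (t : V' ⊗ W') :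
  \tsum_(v, w <- s) \tsum_(v', w' <- t) F v w v' w'
  = \tsum_(v', w' <- t) \tsum_(v, w <- s) F v w v' w'.
Proof. exact: exchange_big. Qed.

End MultilinearSums.

(** Proves linearity, bilinearity or trilinearity of an expression by following
    its syntax; the properties of the variable operations are looked up in the
    context. *)
Ltac lin := cbv beta;
  lazymatch goal with
  | |- forall _, _ => intros; lin
  | |- trilinear _ => first [assumption | apply: trilinearP; lin]
  | |- bilinear_for _ _ _ => first [assumption | split; lin]
  | |- GRing.linear_for _ _ => first
    [ assumption
    | exact: linear_id
    | exact: tswap_linear
    | lazymatch goal with
      | |- GRing.linear_for _ (fun x => tsum (@?F x) (@?t x)) => first
        [ apply: linear_tsum_body; lin | apply: linear_tsum_arg; lin ]
      | |- GRing.linear_for _ (fun x => tpure (@?a x) (@?b x)) => first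
        [ apply: (linear_slot_l (f := @tpure _ _ _)); [exact: tpure_bilinear|lin]
        | apply: (linear_slot_r (f := @tpure _ _ _)); [exact: tpure_bilinear|lin]]
      | |- GRing.linear_for _ (tpure _) =>
          exact: (tpure_bilinear _ _).2
      | |- GRing.linear_for _ (fun x => nmul (@?a x) (@?b x)) => first
        [ apply: (linear_slot_l (f := @nmul _ _)); [exact: nmul_bilinear|lin]
        | apply: (linear_slot_r (f := @nmul _ _)); [exact: nmul_bilinear|lin]]
      | |- GRing.linear_for _ (nmul ?a) => exact: (@nmul_bilinear _ _).2
      | |- GRing.linear_for _ (fun x => tswap (@?a x)) =>
          apply: (linear_after (f := @tswap _ _ _)); [exact: tswap_linear|lin]
      | |- GRing.linear_for _ (fun x => GRing.scale (@?a x) (@?b x)) => first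
        [ apply: linear_scale_r; lin
        | match goal with
          | H : GRing.linear_for _ ?e |- _ =>
              apply: (linear_scale_l (e := e)); [exact: H|lin]
          end ]
      end
    | match goal with
      | H : bilinear_for _ _ ?f |- GRing.linear_for _ (?f ?u) => exact: (H.2 u)
      | H : bilinear_for _ _ ?f
        |- GRing.linear_for _ (fun x => ?f (@?a x) (@?b x)) => first
        [ apply: (linear_slot_l (f := f)); [exact: H|lin]
        | apply: (linear_slot_r (f := f)); [exact: H|lin]]
      | H : trilinear ?f
        |- GRing.linear_for _ (fun x => ?f (@?a x) (@?b x) (@?c x)) => first
        [ apply: (trilinear_slot1 (F := f)); [exact: H|lin]
        | apply: (trilinear_slot2 (F := f)); [exact: H|lin]
        | apply: (trilinear_slot3 (F := f)); [exact: H|lin]]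
      | H : trilinear ?f |- GRing.linear_for _ (?f ?u ?v) =>
          exact: ((H.2 u).2 v)
      | H : GRing.linear_for _ ?f |- GRing.linear_for _ (fun x => ?f (@?a x)) =>
          apply: (linear_after (f := f)); [exact: H|lin]
      end ]
  end.

(** * Isomorphic twisted products *)

Section TwistedProducts.
Variables (k : fieldType) (A B : lmodType k).
Variables (mA : A -> A -> A) (mB : B -> B -> B).
Variables lam rho sig : A -> B -> B ⊗ A.
Hypotheses (mA_bil : bilinear2 mA) (mB_bil : bilinear2 mB).
Hypotheses (lam_bil : bilinear2 lam) (rho_bil : bilinear2 rho)
  (sig_bil : bilinear2 sig).
Hypothesis lam_sig : forall a b, \tsum_(b0, c <- sig a b) lam c b0 = b ⊗ a.
Hypothesis sig_lam : forall a b, \tsum_(b0, c <- lam a b) sig c b0 = b ⊗ a.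
Hypothesis lam_mB : forall a b b', lam a (mB b b') =
  \tsum_(b'0, c <- lam a b') \tsum_(b0, d <- lam c b) (mB b0 b'0) ⊗ d.
Hypothesis lam_mA : forall a a' b, lam (mA a a') b =
  \tsum_(b0, c <- lam a b) \tsum_(b00, c' <- lam a' b0) b00 ⊗ (mA c c').
Hypothesis lam_rho_coact : forall (Z : lmodType k) (F : A -> A -> B -> Z), trilinear F ->
  forall a a' b,
  \tsum_(b0, c <- lam a b) \tsum_(b00, c' <- rho a' b0) F c c' b00
  = \tsum_(b0, c' <- rho a' b) \tsum_(b00, c <- lam a b0) F c c' b00.
Hypothesis lam_rho_act : forall (Z : lmodType k) (F : B -> B -> A -> Z), trilinear F ->
  forall a b b',
  \tsum_(b0, c <- lam a b) \tsum_(b'0, d <- rho c b') F b0 b'0 d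
  = \tsum_(b'0, c <- rho a b') \tsum_(b0, d <- lam c b) F b0 b'0 d.

Variables mu nu : B ⊗ A -> B ⊗ A -> B ⊗ A.
Hypotheses (mu_bil : bilinear2 mu) (nu_bil : bilinear2 nu).
Hypothesis muE : forall b' a' b a, mu (b' ⊗ a') (b ⊗ a) =
  \tsum_(b'0, c <- lam a b') \tsum_(b0, c' <- rho a' b) (mB b'0 b0) ⊗ (mA c' c).
Hypothesis nuE : forall b' a' b a, nu (b' ⊗ a') (b ⊗ a) =
  \tsum_(b0, c <- rho a' b) \tsum_(b00, d <- sig c b0) (mB b' b00) ⊗ (mA d a).

Let f (t : B ⊗ A) : B ⊗ A := \tsum_(b, a <- t) sig a b.
Let h (t : B ⊗ A) : B ⊗ A := \tsum_(b, a <- t) lam a b.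

Let f_lin : linear f. Proof. by rewrite /f; lin. Qed.
Let h_lin : linear h. Proof. by rewrite /h; lin. Qed.

Let fK : cancel f h.
Proof.
apply: tens_lin_ext => [||b a]; try by lin.
by rewrite /f tsumE ?lam_sig //; lin.
Qed.

Let hK : cancel h f.
Proof.
apply: tens_lin_ext => [||b a]; try by lin.
by rewrite /h tsumE ?sig_lam //; lin.
Qed.

(** Multiplicativity is proved for the inverse h of the isomorphism: in h (nu _ _)
    the map sig occurs only under lam, so that it cancels, whereas in f (mu _ _)
    the rules [lam_mA] and [lam_mB] would first have to be transported to sig. *)
Let hM_pure b' a' b a : h (nu (b' ⊗ a') (b ⊗ a))
  = mu (h (b' ⊗ a')) (h (b ⊗ a)).
Proof.
rewrite nuE /h tsum_comp; last by lin.
transitivity (\tsum_(b0, c <- rho a' b) \tsum_(b00, d <- lam a b0)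
  \tsum_(b'0, e <- lam (mA c d) b') (mB b'0 b00) ⊗ e).
  apply: eq_tsum => b0 c; rewrite tsum_comp; last by lin.
  (* lam now meets sig in the argument of a bilinear map G, where it cancels. *)
  pose G b1 c1 := \tsum_(b00, d <- lam a b1)
    \tsum_(b'0, e <- lam (mA c1 d) b') (mB b'0 b00) ⊗ e.
  have G_bil : bilinear2 G by rewrite /G; lin.
  transitivity (tsum G (\tsum_(b1, d <- sig c b0) lam d b1)); last first.
    by rewrite lam_sig tsumE.
  rewrite tsum_comp //; apply: eq_tsum => b00 d; rewrite tsumE; last by lin.
  rewrite lam_mB lam_mA tsum_comp; last by lin.
  apply: eq_tsum => b1 e; rewrite tsum_comp; last by lin.
  by apply: eq_tsum => b2 e'; rewrite tsumE //; lin.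
rewrite -lam_rho_coact; last by lin.
rewrite !tsumE; try by lin.
rewrite -[X in mu X]tsum_tpure -[X in mu _ X]tsum_tpure.
rewrite (lin_tsum (g := mu^~ _)); last by lin.
transitivity (\tsum_(b'0, d <- lam a' b') \tsum_(b0, c <- lam a b)
    mu (b'0 ⊗ d) (b0 ⊗ c)); last first.
  by apply: eq_tsum => b'0 d; rewrite lin_tsum //; lin.
rewrite [RHS]tsum_exchange; apply: eq_tsum => b0 c.
transitivity (\tsum_(b00, c' <- rho a' b0) \tsum_(b'0, e <- lam c' b')
    \tsum_(b'1, e' <- lam c b'0) (mB b'1 b00) ⊗ (mA e e')).
  apply: eq_tsum => b00 c'; rewrite lam_mA tsum_comp; last by lin.
  apply: eq_tsum => b'0 e; rewrite tsum_comp; last by lin.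
  by apply: eq_tsum => b'1 e'; rewrite tsumE //; lin.
rewrite -(lam_rho_act (F := fun b'0 b00 e =>
  \tsum_(b'1, e' <- lam c b'0) (mB b'1 b00) ⊗ (mA e e'))); last by lin.
by apply: eq_tsum => b'0 d; rewrite muE tsum_exchange.
Qed.

(** Of the two ways to commute lam with rho, [lam_rho_coact] has both of them
    coact on the same element of B, while [lam_rho_act] has both act on the same
    element of A. *)
Lemma twisted_products_iso : exists g, algebra_iso mu nu g.
Proof.
have hM s t : h (nu s t) = mu (h s) (h t).
  by move: s t; apply: tens_bilin_ext; first [exact: hM_pure | lin].
exists f; split=> // [|s t]; first by exists h.
by apply: (can_inj hK); rewrite fK hM !fK.
Qed.

End TwistedProducts.

(** * Covered coactions *)

(** T1 x y stands for Delta(x)(1 ⊗ y) and T2 x y for (x ⊗ 1)Delta(y).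
    [hopf_T1_det] and [hopf_T2_det] are the form in which their surjectivity is
    used.  The antipode identities are S^-1(x_2 y) x_1 = eps(x) S^-1(y) and
    y_2 S^-1(x y_1) = eps(y) S^-1(x). *)
Record covered_hopf (k : fieldType) (Q : lmodType k) (qm : Q -> Q -> Q)
    (T1 T2 : Q -> Q -> Q ⊗ Q) (eps : Q -> k) (S Sinv : Q -> Q) : Prop := {
  hopf_mul_bilinear : bilinear2 qm;
  hopf_units : forall s : seq Q, exists e, forall x, x \in s ->
    qm e x = x /\ qm x e = x;
  hopf_eps_linear : linear (eps : Q -> k^o);
  hopf_epsM : forall x y, eps (qm x y) = eps x * eps y;
  hopf_counit_T1 : forall x y, \tsum_(u, v <- T1 x y) (eps u *: v) = qm x y;
  hopf_counit_T2 : forall x y, \tsum_(u, v <- T2 x y) (eps v *: u) = qm x y;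
  hopf_T1_det : forall (Z : lmodType k) (f g : Q -> Q -> Z),
    bilinear2 f -> bilinear2 g ->
    (forall x y, tsum f (T1 x y) = tsum g (T1 x y)) -> forall x y, f x y = g x y;
  hopf_T2_det : forall (Z : lmodType k) (f g : Q -> Q -> Z),
    bilinear2 f -> bilinear2 g ->
    (forall x y, tsum f (T2 x y) = tsum g (T2 x y)) -> forall x y, f x y = g x y;
  hopf_S_linear : linear S;
  hopf_Sinv_linear : linear Sinv;
  hopf_SinvM : forall x y, Sinv (qm x y) = qm (Sinv y) (Sinv x);
  hopf_SK : cancel S Sinv;
  hopf_Sinv_T1 : forall x y,
    \tsum_(u, v <- T1 x y) qm (Sinv v) u = eps x *: Sinv y;
  hopf_Sinv_T2 : forall x y,
    \tsum_(u, v <- T2 x y) qm v (Sinv u) = eps y *: Sinv x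
}.

(** For T = T1 and G b x = Gamma(b)(x ⊗ 1), both sides sum F over
    (Delta ⊗ id)Gamma(b) multiplied on the right with Delta(p)(1 ⊗ r) ⊗ 1.  For
    T p r = T2 r p and G b x = (x ⊗ 1)Gamma(b), it is the same with the
    multiplication by (r ⊗ 1)Delta(p) ⊗ 1 on the left. *)
Definition coassociative (k : fieldType) (Q B : lmodType k)
    (T : Q -> Q -> Q ⊗ Q) (G : B -> Q -> Q ⊗ B) : Prop :=
  forall (Z : lmodType k) (F : Q -> Q -> B -> Z), trilinear F -> forall b p r,
    \tsum_(x, y <- T p r) \tsum_(u, c <- G b x) \tsum_(v, d <- G c y) F u v d
    = \tsum_(q, c <- G b p) \tsum_(u, v <- T q r) F u v c.

(** Gr b x stands for Gamma(b)(x ⊗ 1) and Gl x b for (x ⊗ 1)Gamma(b). *)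
Record covered_coaction (k : fieldType) (Q B : lmodType k) (qm : Q -> Q -> Q)
    (mB : B -> B -> B) (T1 T2 : Q -> Q -> Q ⊗ Q)
    (Gr : B -> Q -> Q ⊗ B) (Gl : Q -> B -> Q ⊗ B) : Prop := {
  coact_r_bilinear : bilinear2 Gr;
  coact_l_bilinear : bilinear2 Gl;
  coact_lr : forall (Z : lmodType k) (H : Q -> B -> Z), bilinear2 H ->
    forall q g b, \tsum_(x, c <- Gl q b) H (qm x g) c
                  = \tsum_(x, c <- Gr b g) H (qm q x) c;
  coact_rM : forall (Z : lmodType k) (H : Q -> B -> Z), bilinear2 H ->
    forall b b' p, tsum H (Gr (mB b b') p)
      = \tsum_(x, c <- Gr b' p) \tsum_(y, d <- Gr b x) H y (mB d c);
  coact_rX : forall (Z : lmodType k) (H : Q -> B -> Z), bilinear2 H ->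
    forall b p r, tsum H (Gr b (qm p r)) = \tsum_(x, c <- Gr b p) H (qm x r) c;
  coact_r_inj : forall b b', (forall p, Gr b p = Gr b' p) -> b = b';
  coact_coassoc_r : coassociative T1 Gr;
  coact_coassoc_l : coassociative (fun p r => T2 r p) (fun b x => Gl x b)
}.

Section CoveredCoaction.
Variables (k : fieldType) (Q A B : lmodType k) (qm : Q -> Q -> Q).
Variables (mA : A -> A -> A) (mB : B -> B -> B).
Variables (T1 T2 : Q -> Q -> Q ⊗ Q) (eps : Q -> k) (S Sinv : Q -> Q).
Variables (Gr : B -> Q -> Q ⊗ B) (Gl : Q -> B -> Q ⊗ B).
Variables (act : Q -> A -> A) (unit : A -> Q).
Hypothesis hopf : covered_hopf qm T1 T2 eps S Sinv.
Hypothesis coaction : covered_coaction qm mB T1 T2 Gr Gl.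
Hypotheses (mA_bil : bilinear2 mA) (mB_bil : bilinear2 mB).
Hypothesis act_bil : bilinear2 act.
Hypothesis actA : forall x y a, act (qm x y) a = act x (act y a).
Hypothesis act_unit : forall a, act (unit a) a = a.
Hypothesis act_mA : forall x p a b, act x (mA a (act p b)) =
  \tsum_(u, v <- T1 x p) mA (act u a) (act v b).

Let qm_bil := hopf_mul_bilinear hopf.
Let S_lin := hopf_S_linear hopf.
Let Sinv_lin := hopf_Sinv_linear hopf.
Let Gr_bil := coact_r_bilinear coaction.
Let Gl_bil := coact_l_bilinear coaction.

Let eps_lin := hopf_eps_linear hopf.

Let tpureZl (V W : lmodType k) c (v : V) (w : W) : (c *: v) ⊗ w = c *: (v ⊗ w).
Proof. exact: (linZ ((tpure_bilinear V W).1 w)). Qed.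
Let tpureZr (V W : lmodType k) c (v : V) (w : W) : v ⊗ (c *: w) = c *: (v ⊗ w).
Proof. exact: (linZ ((tpure_bilinear V W).2 v)). Qed.

Let cancel_l (t t' : Q ⊗ B) :
  (forall y, \tsum_(v, c <- t) (qm y v) ⊗ c = \tsum_(v, c <- t') (qm y v) ⊗ c) ->
  t = t'.
Proof.
have [e he] := hopf_units hopf (map fst (repr t) ++ map fst (repr t')).
move/(_ e); have unitl s : {subset map fst (repr s) <=
    map fst (repr t) ++ map fst (repr t')} ->
    \tsum_(v, c <- s) (qm e v) ⊗ c = s :> Q ⊗ B.
  move=> sub; rewrite -[RHS]tsum_tpure; apply: eq_big_seq => p ps.
  by rewrite (he _ (sub _ (map_f _ ps))).1.
by rewrite !unitl // => x xs; rewrite mem_cat xs ?orbT.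
Qed.

(** Coassociativity and the counit law of T1 show that Gamma takes the same
    covered values on (eps ⊗ id)(Gamma(b)(x ⊗ 1)) and on eps(x)b; as it is
    injective, these elements of B are equal. *)
Let coaction_counit_r b p : \tsum_(x, c <- Gr b p) (eps x *: c) = eps p *: b.
Proof.
pose N x := \tsum_(u, c <- Gr b x) (eps u *: c).
have N_lin : linear N by rewrite /N; lin.
apply: (coact_r_inj coaction) => r.
pose f x y := Gr (N x) y.
pose g x y := Gr (eps x *: b) y.
rewrite -/(f p r) -/(g p r); move: p r.
apply: (hopf_T1_det hopf) => [||p r]; [rewrite /f; lin|rewrite /g; lin|].
transitivity (\tsum_(x, y <- T1 p r) \tsum_(u, c <- Gr b x)
    \tsum_(v, d <- Gr c y) (eps u *: (v ⊗ d))).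
  apply: eq_tsum => x y; rewrite /f (lin_tsum (g := Gr^~ y)); last by lin.
  apply: eq_tsum => u c.
  have <- := lin_tsum (g := fun t : Q ⊗ B => eps u *: t) (@tpure k Q B) (Gr c y);
    last by lin.
  by rewrite tsum_tpure (linZ (Gr_bil.1 y)).
rewrite (coact_coassoc_r coaction (F := fun u v d => eps u *: (v ⊗ d))); last by lin.
transitivity (Gr b (qm p r)).
  rewrite -[RHS]tsum_tpure (coact_rX coaction); last by lin.
  apply: eq_tsum => q c; rewrite -(hopf_counit_T1 hopf).
  rewrite (lin_tsum (g := fun v : Q => v ⊗ c)); last by lin.
  by apply: eq_tsum => u v; rewrite tpureZl.
rewrite -(hopf_counit_T1 hopf) (lin_tsum (g := Gr b)); last by lin.
by apply: eq_tsum => x y; rewrite /g (linZ (Gr_bil.1 y)) (linZ (Gr_bil.2 b)).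
Qed.

(** This reduces to the right cover by a local unit g, as
    (p ⊗ 1)Gamma(b) = (p ⊗ 1)Gamma(b)(g ⊗ 1) and pg = p. *)
Let coaction_counit_l b p : \tsum_(x, c <- Gl p b) (eps x *: c) = eps p *: b.
Proof.
have [g hg] := hopf_units hopf (p :: map fst (repr (Gl p b))).
transitivity (\tsum_(x, c <- Gl p b) (eps (qm x g) *: c)).
  apply: eq_big_seq => q qs.
  by rewrite (hg q.1 _).2 // inE map_f ?orbT.
rewrite (coact_lr coaction (H := fun x c => eps x *: c)); last by lin.
rewrite -[in RHS](hg p _).2 ?inE ?eqxx // (hopf_epsM hopf) -scalerA.
rewrite -(coaction_counit_r b g) (lin_tsum (g := fun v : B => eps p *: v)); last by lin.
by apply: eq_tsum => x c; rewrite (hopf_epsM hopf) scalerA.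
Qed.

(** This is b_-1 S^-1(r b_-2) ⊗ b_0 = S^-1(r) ⊗ b.  To replace
    b_-2 ⊗ b_-1 by the coproduct of one factor, both of them must be covered.
    Multiplying with y on the left provides the second cover: for x ⊗ y in the
    range of T2, coassociativity turns y b_-1 S^-1(x b_-2) into an antipode
    identity. *)
Let coaction_Sinv_l r b : \tsum_(z, c <- Gl r b) Gr c (Sinv z) = Sinv r ⊗ b.
Proof.
pose E x := \tsum_(z, c <- Gl x b) Gr c (Sinv z).
have E_lin : linear E by rewrite /E; lin.
apply: cancel_l => w.
pose f x y := \tsum_(v, c <- E x) (qm y v) ⊗ c.
pose g x y := \tsum_(v, c <- Sinv x ⊗ b) (qm y v) ⊗ c.
rewrite -/(E r) -/(f r w) -/(g r w); move: r w.
apply: (hopf_T2_det hopf) => [||r w]; [rewrite /f; lin|rewrite /g; lin|].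
transitivity (\tsum_(x, y <- T2 r w) \tsum_(u, c <- Gl x b)
    \tsum_(v, d <- Gl y c) (qm v (Sinv u)) ⊗ d).
  apply: eq_tsum => x y; rewrite /f tsum_comp; last by lin.
  apply: eq_tsum => z c.
  by rewrite (coact_lr coaction (H := fun v d => v ⊗ d)) //; lin.
rewrite (coact_coassoc_l coaction (F := fun u v d => (qm v (Sinv u)) ⊗ d)); last by lin.
transitivity (Sinv r ⊗ (eps w *: b)).
  rewrite -coaction_counit_l lin_tsum; last by lin.
  apply: eq_tsum => q c; rewrite tpureZr -tpureZl -(hopf_Sinv_T2 hopf).
  by rewrite (lin_tsum (g := fun v : Q => v ⊗ c)) //; lin.
rewrite tpureZr -tpureZl -(hopf_Sinv_T2 hopf).
rewrite (lin_tsum (g := fun v : Q => v ⊗ b)); last by lin.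
by apply: eq_tsum => x y; rewrite /g tsumE //; lin.
Qed.

(** This is S^-1(b_-1) b_-2 p ⊗ b_0 = p ⊗ b, the first factor being read as
    S^-1(S(b_-2 p) b_-1).  The second cover is obtained by multiplying with
    S^-1(y) on the left. *)
Let coaction_Sinv_r b p : \tsum_(x, c <- Gr b p)
  \tsum_(z, d <- Gl (S x) c) Sinv z ⊗ d = p ⊗ b.
Proof.
pose E x := \tsum_(q, c <- Gr b x) \tsum_(z, d <- Gl (S q) c) Sinv z ⊗ d.
have E_lin : linear E by rewrite /E; lin.
apply: cancel_l => w.
pose f x y := \tsum_(v, c <- E x) (qm (Sinv y) v) ⊗ c.
pose g x y := \tsum_(v, c <- x ⊗ b) (qm (Sinv y) v) ⊗ c.
(* y = S w makes the factor S^-1(y) an arbitrary element of Q. *)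
rewrite -/(E p) -[w](hopf_SK hopf) -/(f p (S w)) -/(g p (S w)).
move: (S w) => r; move: p r.
apply: (hopf_T1_det hopf) => [||p r]; [rewrite /f; lin|rewrite /g; lin|].
transitivity (\tsum_(x, y <- T1 p r) \tsum_(u, c <- Gr b x)
    \tsum_(v, d <- Gr c y) (qm (Sinv v) u) ⊗ d).
  apply: eq_tsum => x y; rewrite /f tsum_comp; last by lin.
  apply: eq_tsum => q c; rewrite tsum_comp; last by lin.
  transitivity (\tsum_(z, d <- Gl (S q) c) Sinv (qm z y) ⊗ d).
    by apply: eq_tsum => z d; rewrite tsumE ?(hopf_SinvM hopf) //; lin.
  rewrite (coact_lr coaction (H := fun v d => Sinv v ⊗ d)); last by lin.
  by apply: eq_tsum => v d; rewrite (hopf_SinvM hopf) (hopf_SK hopf).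
rewrite (coact_coassoc_r coaction (F := fun u v d => (qm (Sinv v) u) ⊗ d)); last by lin.
transitivity (Sinv r ⊗ (eps p *: b)).
  rewrite -coaction_counit_r lin_tsum; last by lin.
  apply: eq_tsum => q c; rewrite tpureZr -tpureZl -(hopf_Sinv_T1 hopf).
  by rewrite (lin_tsum (g := fun v : Q => v ⊗ c)) //; lin.
rewrite tpureZr -tpureZl -(hopf_Sinv_T1 hopf).
rewrite (lin_tsum (g := fun v : Q => v ⊗ b)); last by lin.
by apply: eq_tsum => x y; rewrite /g tsumE //; lin.
Qed.

(** The map a, b |-> b_0 ⊗ (b_-1 |> a), covered by a = unit a |> a. *)
Definition coact_twist : A -> B -> B ⊗ A :=
  twist (fun a x => act x a) (fun q b => tswap (Gr b q)) unit.

(** The map a, b |-> b_0 ⊗ (S^-1(b_-1) |> a); the cover of b_-1 on the left is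
    S (unit a), since S^-1(S(e) b_-1) = S^-1(b_-1) e. *)
Definition coact_twist_inv : A -> B -> B ⊗ A :=
  twist (fun a z => act (Sinv z) a) (fun q b => tswap (Gl q b))
    (fun a => S (unit a)).

Let act_op_bil : bilinear2 (fun a x => act x a).
Proof. exact: bilinear2_sym. Qed.
Let act_Sinv_bil : bilinear2 (fun a z => act (Sinv z) a).
Proof. by lin. Qed.

Let swap_lr q g b : tmap id (fun x => qm x g) (tswap (Gl q b))
  = tmap id (fun x => qm q x) (tswap (Gr b g)).
Proof.
rewrite /tmap !tsum_tswap; try by lin.
by rewrite (coact_lr coaction (H := fun x c => c ⊗ x)) //; lin.
Qed.

Let units_l (s : seq Q) : exists g, forall x, x \in s -> qm g x = x.
Proof. by have [g hg] := hopf_units hopf s; exists g => x /hg[]. Qed.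
Let units_r (s : seq Q) : exists g, forall x, x \in s -> qm x g = x.
Proof. by have [g hg] := hopf_units hopf s; exists g => x /hg[]. Qed.

Lemma coact_twist_bilinear : bilinear2 coact_twist.
Proof.
apply: (twist_bilinear (qm := fun x y => qm y x)
  (G := fun g b => tswap (Gl g b))) => // *; by lin.
Qed.

Lemma coact_twistE c q b :
  coact_twist (act q c) b = \tsum_(x, b0 <- Gr b q) b0 ⊗ act x c.
Proof.
rewrite /coact_twist (twistE (act := fun a x => act x a)
  (qm := fun x y => qm y x) (G := fun g b => tswap (Gl g b))) //.
by rewrite tsum_tswap //; lin.
Qed.

Lemma coact_twist_inv_bilinear : bilinear2 coact_twist_inv.
Proof.
apply: (twist_bilinear (qm := qm) (G := fun g b => tswap (Gr b g))) => // *.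
- by rewrite (hopf_SinvM hopf) actA.
- by lin.
- by rewrite (hopf_SK hopf).
Qed.

Lemma coact_twist_invE c q b :
  coact_twist_inv (act q c) b = \tsum_(z, b0 <- Gl (S q) b) b0 ⊗ act (Sinv z) c.
Proof.
rewrite -{1}[q](hopf_SK hopf).
rewrite /coact_twist_inv (twistE (act := fun a z => act (Sinv z) a)
  (qm := qm) (G := fun g b => tswap (Gr b g))) // => *.
- by rewrite tsum_tswap //; lin.
- by rewrite (hopf_SinvM hopf) actA.
- by rewrite (hopf_SK hopf).
Qed.

Let lam_bil := coact_twist_bilinear.
Let sig_bil := coact_twist_inv_bilinear.

Lemma coact_twist_invK a b :
  \tsum_(b0, c <- coact_twist_inv a b) coact_twist c b0 = b ⊗ a.
Proof.
rewrite -[a]act_unit coact_twist_invE tsum_comp; last by lin.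
transitivity (\tsum_(x, b0 <- Sinv (S (unit a)) ⊗ b) b0 ⊗ act x a).
  rewrite -coaction_Sinv_l tsum_comp; last by lin.
  by apply: eq_tsum => z b0; rewrite tsumE ?coact_twistE //; lin.
by rewrite tsumE ?(hopf_SK hopf) //; lin.
Qed.

Lemma coact_twistK a b :
  \tsum_(b0, c <- coact_twist a b) coact_twist_inv c b0 = b ⊗ a.
Proof.
rewrite -[a]act_unit coact_twistE tsum_comp; last by lin.
transitivity (\tsum_(x, b0 <- unit a ⊗ b) b0 ⊗ act x a); last first.
  by rewrite tsumE //; lin.
rewrite -coaction_Sinv_r tsum_comp; last by lin.
apply: eq_tsum => x c; rewrite tsumE; last by lin.
rewrite coact_twist_invE tsum_comp; last by lin.
by apply: eq_tsum => z d; rewrite tsumE //; lin.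
Qed.

Lemma coact_twist_mulB a b b' : coact_twist a (mB b b') =
  \tsum_(c, d <- coact_twist a b') \tsum_(c', e <- coact_twist d b)
    (mB c' c) ⊗ e.
Proof.
rewrite -[a]act_unit !coact_twistE (coact_rM coaction); last by lin.
rewrite tsum_comp; last by lin.
apply: eq_tsum => x b'0; rewrite tsumE; last by lin.
rewrite coact_twistE tsum_comp; last by lin.
by apply: eq_tsum => y b0; rewrite tsumE //; lin.
Qed.

(** This is the module algebra axiom, together with coassociativity.  That axiom
    speaks of x |> (a (p |> b)) rather than of (p |> a)(r |> b); T1 being onto, it
    is enough to compare the two sides summed over T1 p r, where it applies. *)
Lemma coact_twist_mulA a a' b : coact_twist (mA a a') b =
  \tsum_(b0, c <- coact_twist a b) \tsum_(b00, c' <- coact_twist a' b0)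
    b00 ⊗ (mA c c').
Proof.
rewrite -[a]act_unit -[a']act_unit; move: (unit a) (unit a') => p r.
pose f p r := coact_twist (mA (act p a) (act r a')) b.
pose g p r := \tsum_(b0, c <- coact_twist (act p a) b)
  \tsum_(b00, c' <- coact_twist (act r a') b0) b00 ⊗ (mA c c').
rewrite -/(f p r) -/(g p r); move: p r.
apply: (hopf_T1_det hopf) => [||p r]; [rewrite /f; lin|rewrite /g; lin|].
transitivity (coact_twist (act p (mA a (act r a'))) b).
  by rewrite act_mA (lin_tsum (g := coact_twist^~ b)) //; lin.
rewrite coact_twistE.
transitivity (\tsum_(q, b0 <- Gr b p) \tsum_(u, v <- T1 q r)
    b0 ⊗ mA (act u a) (act v a')).
  by apply: eq_tsum => q b0; rewrite act_mA lin_tsum //; lin.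
rewrite -(coact_coassoc_r coaction
  (F := fun u v b0 => b0 ⊗ mA (act u a) (act v a'))); last by lin.
apply: eq_tsum => x y; rewrite /g coact_twistE tsum_comp; last by lin.
apply: eq_tsum => u c; rewrite tsumE; last by lin.
rewrite coact_twistE tsum_comp; last by lin.
by apply: eq_tsum => v d; rewrite tsumE //; lin.
Qed.

End CoveredCoaction.

(** * Mirror images *)

(** For the opposite product and the opposite coproduct, Delta(x)(1 ⊗ y) is the
    flip of (y ⊗ 1)Delta(x), so that T1 and T2 change places; the antipode
    remains the same. *)
Lemma covered_hopf_mirror (k : fieldType) (Q : lmodType k) (qm : Q -> Q -> Q)
    (T1 T2 : Q -> Q -> Q ⊗ Q) (eps : Q -> k) (S Sinv : Q -> Q) :
  covered_hopf qm T1 T2 eps S Sinv ->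
  covered_hopf (fun x y => qm y x) (fun x y => tswap (T2 y x))
    (fun x y => tswap (T1 y x)) eps S Sinv.
Proof.
case=> qb un el eM c1 c2 d1 d2 Sl Sil SM SK S1 S2.
split=> //; try by lin.
- by move=> s; have [e he] := un s; exists e => x /he[].
- by move=> x y; rewrite eM mulrC.
- by move=> x y; rewrite tsum_tswap ?c2 //; lin.
- by move=> x y; rewrite tsum_tswap ?c1 //; lin.
- move=> Z f g bf bg fg x y; move: y x.
  apply: (d2 Z (fun y x => f x y) (fun y x => g x y)); try by lin.
  by move=> u v; have := fg v u; rewrite !tsum_tswap.
- move=> Z f g bf bg fg x y; move: y x.
  apply: (d1 Z (fun y x => f x y) (fun y x => g x y)); try by lin.
  by move=> u v; have := fg v u; rewrite !tsum_tswap.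
- by move=> x y; rewrite tsum_tswap ?S2 //; lin.
- by move=> x y; rewrite tsum_tswap ?S1 //; lin.
Qed.

(** * From right covers to left covers *)

Lemma tens_local_units (k : fieldType) (V W : nalgType k) :
  local_units V -> local_units W -> local_units (tensor V W).
Proof.
move=> V_units W_units s.
have [e he] := V_units (flatten [seq map fst (repr t) | t <- s]).
have [f hf] := W_units (flatten [seq map snd (repr t) | t <- s]).
have mem (U : eqType) (t : V ⊗ W) (F : V * W -> U) p : t \in s -> p \in repr t ->
    F p \in flatten [seq map F (repr t) | t <- s].
  by move=> ts pt; apply/flatten_mapP; exists t; rewrite ?map_f.
exists (e ⊗ f) => t ts; split; rewrite -[in LHS](tsum_tpure t).
- rewrite -[RHS]tsum_tpure lin_tsum; last by lin.
  apply: eq_big_seq => p pt; rewrite tens_mulE.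
  by rewrite (he _ (mem _ t fst p ts pt)).1 (hf _ (mem _ t snd p ts pt)).1.
- rewrite -[RHS]tsum_tpure (lin_tsum (g := fun t => t ** (e ⊗ f))); last by lin.
  apply: eq_big_seq => p pt; rewrite tens_mulE.
  by rewrite (he _ (mem _ t fst p ts pt)).2 (hf _ (mem _ t snd p ts pt)).2.
Qed.

Lemma nondegenerate_extl (k : fieldType) (V : nalgType k) :
  nondegenerate_product V -> forall a b : V, (forall c, a ** c = b ** c) -> a = b.
Proof.
move=> nd a b ab; apply/eqP; rewrite -subr_eq0; apply/eqP; apply: (nd _).1 => c.
by rewrite nmulDl -scaleN1r nmulZl scaleN1r ab subrr.
Qed.

Lemma nondegenerate_extr (k : fieldType) (V : nalgType k) :
  nondegenerate_product V -> forall a b : V, (forall c, c ** a = c ** b) -> a = b.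
Proof.
move=> nd a b ab; apply/eqP; rewrite -subr_eq0; apply/eqP; apply: (nd _).2 => c.
by rewrite nmulDr -scaleN1r nmulZr scaleN1r ab subrr.
Qed.

Section CoassociativityTransfer.
Variables (k : fieldType) (Q B : nalgType k).
Hypotheses (Q_units : local_units Q) (B_units : local_units B).
Variables (T T' : Q -> Q -> Q ⊗ Q) (D : Q -> Q -> Q -> Q ⊗ Q).
Variables (G G' : B -> Q -> Q ⊗ B).
Hypotheses (G_bil : bilinear2 G) (G'_bil : bilinear2 G').
Hypothesis T_det : forall (Z : lmodType k) (f g : Q -> Q -> Z),
  bilinear2 f -> bilinear2 g ->
  (forall x y, tsum f (T x y) = tsum g (T x y)) -> forall x y, f x y = g x y.
Hypothesis D_lin : forall p r, linear (fun x => D p x r).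
Hypothesis TT : forall p q p' r, T' q p ** T p' r = D p (q ** p') r.
Hypothesis GG : forall (Z : lmodType k) (H : Q -> B -> Z), bilinear2 H ->
  forall q g b, \tsum_(x, c <- G' b q) H (x ** g) c
                = \tsum_(x, c <- G b g) H (q ** x) c.

(** Here (T, G) is one of the two covers and (T', G') the opposite one.  For
    T = T1 and T' p r = T2 r p the hypothesis [TT] holds with
    D p x r = (p ⊗ 1)Delta(x)(1 ⊗ r).  The two sides of coassociativity for T'
    and G' are elements of (Q ⊗ Q) ⊗ B; it is enough to compare them after
    multiplication by T p' r' ⊗ e.  The cover then moves from the left to the
    right through [GG] and [TT], where coassociativity for T and G applies. *)
Lemma coassociative_transfer : coassociative T G -> coassociative T' G'.
Proof.
move=> coT.
suff main b p r :
    \tsum_(x, y <- T' p r) \tsum_(u, c <- G' b x) \tsum_(v, d <- G' c y)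
      (u ⊗ v) ⊗ d
    = \tsum_(q, c <- G' b p) T' q r ⊗ c.
  move=> Z F triF b p r.
  pose Phi (t : (Q ⊗ Q) ⊗ B) := \tsum_(s, d <- t) \tsum_(u, v <- s) F u v d.
  have Phi_bil : bilinear2 (fun s d => \tsum_(u, v <- s) F u v d) by lin.
  have Phi_lin : linear Phi by rewrite /Phi; lin.
  transitivity (Phi (\tsum_(x, y <- T' p r) \tsum_(u, c <- G' b x)
      \tsum_(v, d <- G' c y) (u ⊗ v) ⊗ d)).
    rewrite /Phi; do 3![rewrite tsum_comp //; apply: eq_tsum => ? ?].
    by rewrite !tsumE //; lin.
  rewrite main /Phi tsum_comp //.
  by apply: eq_tsum => q c; rewrite tsumE.
set s1 := LHS; set s2 := RHS.
apply: (nondegenerate_extl (tens_nondegenerate (tens_local_units Q_units Q_units)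
  B_units)).
apply: tens_lin_ext => [||t e]; try by lin.
move: t; apply: tens_lin_ext => [||x y]; try by lin.
pose f x y := s1 ** ((x ⊗ y) ⊗ e); pose g x y := s2 ** ((x ⊗ y) ⊗ e).
rewrite -/(f x y) -/(g x y); move: x y.
apply: T_det => [||p' r']; [rewrite /f; lin|rewrite /g; lin|].
transitivity (\tsum_(x', y' <- T p' r') \tsum_(x, y <- T' p r)
    \tsum_(u, c <- G b x') \tsum_(v, d <- G c y')
      ((x ** u) ⊗ (y ** v)) ⊗ (d ** e)).
  apply: eq_tsum => x' y'; rewrite /f /s1.
  rewrite (lin_tsum (g := nmul^~ _)); last by lin.
  apply: eq_tsum => x y.
  rewrite (lin_tsum (g := nmul^~ _)); last by lin.
  pose K (u : Q) (c : B) := \tsum_(v, d <- G c y') (u ⊗ (y ** v)) ⊗ (d ** e).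
  have K_bil : bilinear2 K by rewrite /K; lin.
  rewrite -(GG K_bil); apply: eq_tsum => u c.
  rewrite (lin_tsum (g := nmul^~ _)); last by lin.
  rewrite /K -(GG (H := fun v d => ((u ** x') ⊗ v) ⊗ (d ** e))); last by lin.
  by apply: eq_tsum => v d; rewrite !tens_mulE.
rewrite tsum_exchange.
transitivity (\tsum_(x, y <- T' p r) \tsum_(q, c <- G b p')
    \tsum_(u, v <- T q r') ((x ** u) ⊗ (y ** v)) ⊗ (c ** e)).
  apply: eq_tsum => x y.
  by rewrite -(coT _ (fun u v d => ((x ** u) ⊗ (y ** v)) ⊗ (d ** e))) //; lin.
have TTE q q' c : \tsum_(x, y <- T' q r) \tsum_(u, v <- T q' r')
    ((x ** u) ⊗ (y ** v)) ⊗ c = D r (q ** q') r' ⊗ c.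
  rewrite -TT -[in RHS](tsum_tpure (T' q r)).
  rewrite (lin_tsum (g := nmul^~ _)); last by lin.
  rewrite (lin_tsum (g := fun t => t ⊗ c)); last by lin.
  apply: eq_tsum => x y.
  rewrite -[in RHS](tsum_tpure (T q' r')) lin_tsum; last by lin.
  rewrite (lin_tsum (g := fun t => t ⊗ c)); last by lin.
  by apply: eq_tsum => u v; rewrite tens_mulE.
rewrite tsum_exchange.
transitivity (\tsum_(q, c <- G b p') D r (p ** q) r' ⊗ (c ** e)).
  by apply: eq_tsum => q c; rewrite TTE.
have D_lin' := D_lin r r'.
rewrite -(GG (H := fun q c => D r q r' ⊗ (c ** e))); last by lin.
transitivity (s2 ** (T p' r' ⊗ e)); last first.
  rewrite -{1}[T p' r']tsum_tpure (lin_tsum (g := fun t => s2 ** (t ⊗ e))) //.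
  by lin.
rewrite /s2 (lin_tsum (g := nmul^~ _)); last by lin.
by apply: eq_tsum => q c; rewrite -TT tens_mulE.
Qed.

End CoassociativityTransfer.

(** * Multipliers of tensor products *)

Section MultiplierTensors.
Variable k : fieldType.
Implicit Types V W : nalgType k.

Lemma mtensM V W (m m' : multiplier V) (n n' : multiplier W) :
  mtens m n ** mtens m' n' = mtens (m ** m') (n ** n').
Proof.
apply: mult_ext; apply: tens_lin_ext => [||v w]; try exact: mactl_linear;
  try exact: mactr_linear; by rewrite mult_mulE !mtensE.
Qed.

Lemma memb_tens V W (v : V) (w : W) : memb (v ⊗ w) = mtens (memb v) (memb w).
Proof.
apply: mult_ext; apply: tens_lin_ext => [||v' w']; try exact: mactl_linear;
  try exact: mactr_linear; by rewrite mtensE /= tens_mulE.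
Qed.

Lemma membM V (a b : V) : memb (a ** b) = memb a ** memb b.
Proof. by rewrite membMl. Qed.

Lemma mul1m V (m : multiplier V) : mone ** m = m.
Proof. exact: mult_ext. Qed.
Lemma mulm1 V (m : multiplier V) : m ** mone = m.
Proof. exact: mult_ext. Qed.

Lemma mtens_memb_l_linear V W :
  linear (fun v : V => mtens (memb v) (mone : multiplier W)).
Proof.
move=> c v v'; apply: mult_ext => t /=; rewrite /tmap -tsum_funD;
  by apply: eq_tsum => x y; rewrite (nmul_lin, nmul_linr) tpureDl.
Qed.

Lemma mtens_memb_r_linear V W :
  linear (fun w : W => mtens (mone : multiplier V) (memb w)).
Proof.
move=> c w w'; apply: mult_ext => t /=; rewrite /tmap -tsum_funD;
  by apply: eq_tsum => x y; rewrite (nmul_lin, nmul_linr) tpureDr.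
Qed.

Lemma mswapM V W (m n : multiplier (tensor V W)) : mswap (m ** n) = mswap m ** mswap n.
Proof. by apply: mult_ext => t /=; rewrite tswapK. Qed.

Lemma mswap_linear V W : linear (@mswap k V W).
Proof. by move=> c m n; apply: mult_ext => t /=; rewrite tswap_linear. Qed.

Lemma mswap_inj V W : injective (@mswap k V W).
Proof.
move=> m n mn; apply: mult_ext => t.
  apply: (can_inj (@tswapK _ _ _)); rewrite -[t]tswapK.
  by have := congr1 (fun m => mactl m (tswap t)) mn.
apply: (can_inj (@tswapK _ _ _)); rewrite -[t]tswapK.
by have := congr1 (fun m => mactr m (tswap t)) mn.
Qed.

Lemma mswap_memb V W (t : V ⊗ W) : mswap (memb t) = memb (tswap t).
Proof. by apply: mult_ext => s /=; rewrite tswapM tswapK. Qed.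

Lemma mswap_tens V W (m : multiplier V) (n : multiplier W) :
  mswap (mtens m n) = mtens n m.
Proof.
apply: mult_ext; apply: tens_lin_ext => [||v w];
  try exact: mactl_linear; try exact: mactr_linear.
- rewrite -[LHS]/(tswap (mactl (mtens m n) (tswap (v ⊗ w)))).
  by rewrite tswapE !mtensE tswapE.
- rewrite -[LHS]/(tswap (mactr (mtens m n) (tswap (v ⊗ w)))).
  by rewrite tswapE !mtensE tswapE.
Qed.

End MultiplierTensors.

(** * The covered structure of a multiplier Hopf algebra *)

Lemma bijective_det (k : fieldType) (Q : lmodType k) (T : Q ⊗ Q -> Q ⊗ Q) :
  linear T -> bijective T ->
  forall (Z : lmodType k) (f g : Q -> Q -> Z), bilinear2 f -> bilinear2 g ->
  (forall x y, tsum f (T (x ⊗ y)) = tsum g (T (x ⊗ y))) ->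
  forall x y, f x y = g x y.
Proof.
move=> T_lin [T' _ T'K] Z f g bf bg fg x y.
rewrite -(tsumE x y bf) -(tsumE x y bg) -(T'K (x ⊗ y)).
move: (T' (x ⊗ y)); apply: tens_lin_ext => //; by lin.
Qed.

Section HopfData.
Variables (k : fieldType) (Q : nalgType k) (Delta : Q -> multiplier (Q ⊗ Q)).
Hypotheses (Q_units : local_units Q) (Q_hopf : multiplier_hopf Delta).
Variables S Sinv : Q -> Q.
Hypotheses (S_antipode : is_antipode Delta S).
Hypotheses (SK : cancel S Sinv) (SinvK : cancel Sinv S).

Let QQ_inj : injective (@memb k (tensor Q Q)).
Proof. exact/memb_inj/tens_nondegenerate. Qed.

Let Delta_linear : linear Delta. Proof. by have [[]] := Q_hopf. Qed.
Let DeltaM x y : Delta (x ** y) = Delta x ** Delta y.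
Proof. by have [[_ ->]] := Q_hopf. Qed.

(** The sum defining T1 has the expected value on a pure tensor because its
    summand is bilinear; this is checked in M(Q ⊗ Q), where the summand is a
    product. *)
Lemma T1P x y : memb (T1 Delta (x ⊗ y)) = Delta x ** mtens mone (memb y).
Proof.
have [_ /(_ _ _)/proj1/eltP eP _ _ _] := Q_hopf.
rewrite /T1 tsumE //; apply: bilinear2P => *; apply: QQ_inj;
  rewrite [RHS]memb_linear !eP; first by rewrite Delta_linear nmul_lin.
by rewrite mtens_memb_r_linear nmul_linr.
Qed.

Lemma T2P x y : memb (T2 Delta (x ⊗ y)) = mtens (memb x) mone ** Delta y.
Proof.
have [_ /(_ _ _)/proj2/eltP eP _ _ _] := Q_hopf.
rewrite /T2 tsumE //; apply: bilinear2P => *; apply: QQ_inj;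
  rewrite [RHS]memb_linear !eP; last by rewrite Delta_linear nmul_linr.
by rewrite mtens_memb_l_linear nmul_lin.
Qed.

Lemma T2_linear : linear (T2 Delta).
Proof.
apply: tsum_linear; have [_ /(_ _ _)/proj2/eltP eP _ _ _] := Q_hopf.
apply: bilinear2P => *; apply: QQ_inj; rewrite [RHS]memb_linear !eP.
  by rewrite mtens_memb_l_linear nmul_lin.
by rewrite Delta_linear nmul_linr.
Qed.

Lemma T2_T1_mul p q p' r : T2 Delta (p ⊗ q) ** T1 Delta (p' ⊗ r)
  = tmap (nmul p) id (T1 Delta ((q ** p') ⊗ r)).
Proof.
apply: QQ_inj; rewrite membM T1P T2P.
rewrite -[tmap _ id _]/(mactl (mtens (memb p) mone) _) -membMl T1P DeltaM.
by rewrite !nmulA.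
Qed.

Lemma multiplier_hopf_covered : exists eps, covered_hopf (@nmul k Q)
  (fun x y => T1 Delta (x ⊗ y)) (fun x y => T2 Delta (x ⊗ y)) eps S Sinv.
Proof.
have [S_lin SM [eps [eps_lin epsM c1 c2] antipode]] := S_antipode.
have [_ _ _ T1_bij T2_bij] := Q_hopf.
have Sinv_lin : linear Sinv.
  by move=> c x y; apply: (can_inj SK); rewrite SinvK S_lin !SinvK.
have SinvM x y : Sinv (x ** y) = Sinv y ** Sinv x.
  by apply: (can_inj SK); rewrite SinvK SM !SinvK.
exists eps; split=> //.
- exact: nmul_bilinear.
- exact: bijective_det (T1_linear Q_units Q_hopf) T1_bij.
- exact: bijective_det T2_linear T2_bij.
- move=> x y; rewrite -(linZ Sinv_lin) -(antipode x y).1 lin_tsum //.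
  by apply: eq_tsum => u v; rewrite SinvM SK.
- move=> x y; rewrite -(linZ Sinv_lin) -(antipode x y).2 lin_tsum //.
  by apply: eq_tsum => u v; rewrite SinvM SK.
Qed.

End HopfData.

(** * Coactions by multipliers *)

Section MultiplierCoaction.
Variables (k : fieldType) (Q B : nalgType k).
Hypotheses (Q_units : local_units Q) (B_units : local_units B).
Variable Gamma : B -> multiplier (Q ⊗ B).
Hypotheses (Gamma_inj : injective Gamma) (Gamma_hom : algebra_hom Gamma).
Hypothesis Gamma_in : forall b x,
  inA (Gamma b ** mtens (memb x) mone) /\ inA (mtens (memb x) mone ** Gamma b).
Local Notation Gr := (Gamma_r Gamma).
Local Notation Gl := (Gamma_l Gamma).

Let QB_nondeg : nondegenerate_product (tensor Q B).
Proof. exact: tens_nondegenerate. Qed.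
Let QB_inj : injective (@memb k (tensor Q B)).
Proof. exact: memb_inj. Qed.

Let Gamma_linear : linear Gamma. Proof. by have [] := Gamma_hom. Qed.
Let GammaM b b' : Gamma (b ** b') = Gamma b ** Gamma b'.
Proof. by have [_ ->] := Gamma_hom. Qed.

Lemma Gamma_rP b x : memb (Gr b x) = Gamma b ** mtens (memb x) mone.
Proof. exact: eltP (Gamma_in b x).1. Qed.
Lemma Gamma_lP x b : memb (Gl x b) = mtens (memb x) mone ** Gamma b.
Proof. exact: eltP (Gamma_in b x).2. Qed.

Lemma Gamma_r_bilinear : bilinear2 Gr.
Proof.
apply: bilinear2P => *; apply: QB_inj; rewrite memb_linear !Gamma_rP.
  by rewrite Gamma_linear nmul_lin.
by rewrite mtens_memb_l_linear nmul_linr.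
Qed.

Lemma Gamma_l_bilinear : bilinear2 Gl.
Proof.
apply: bilinear2P => *; apply: QB_inj; rewrite memb_linear !Gamma_lP.
  by rewrite mtens_memb_l_linear nmul_lin.
by rewrite Gamma_linear nmul_linr.
Qed.

Lemma Gamma_lr (Z : lmodType k) (H : Q -> B -> Z) : bilinear2 H ->
  forall q g b, \tsum_(x, c <- Gl q b) H (x ** g) c
                = \tsum_(x, c <- Gr b g) H (q ** x) c.
Proof.
move=> bH q g b.
rewrite -(tsum_tmap (nmul^~ g) id) // -(tsum_tmap (nmul q) id) //.
congr tsum; apply: QB_inj.
rewrite -[tmap _ id _]/(mactr (mtens (memb g) mone) (Gl q b)) -membMr.
rewrite -[tmap _ id _]/(mactl (mtens (memb q) mone) (Gr b g)) -membMl.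
by rewrite Gamma_lP Gamma_rP nmulA.
Qed.

Lemma Gamma_rX (Z : lmodType k) (H : Q -> B -> Z) : bilinear2 H ->
  forall b p r, tsum H (Gr b (p ** r)) = \tsum_(x, c <- Gr b p) H (x ** r) c.
Proof.
move=> bH b p r; rewrite -(tsum_tmap (nmul^~ r) id) //.
congr tsum; apply: QB_inj.
rewrite -[tmap _ id _]/(mactr (mtens (memb r) mone) (Gr b p)) -membMr.
by rewrite !Gamma_rP -nmulA mtensM membM mulm1.
Qed.

Lemma Gamma_lX (Z : lmodType k) (H : Q -> B -> Z) : bilinear2 H ->
  forall b p r, tsum H (Gl (r ** p) b) = \tsum_(x, c <- Gl p b) H (r ** x) c.
Proof.
move=> bH b p r; rewrite -(tsum_tmap (nmul r) id) //.
congr tsum; apply: QB_inj.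
rewrite -[tmap _ id _]/(mactl (mtens (memb r) mone) (Gl p b)) -membMl.
by rewrite !Gamma_lP nmulA mtensM membM mulm1.
Qed.

Lemma Gamma_rM (Z : lmodType k) (H : Q -> B -> Z) : bilinear2 H ->
  forall b b' p, tsum H (Gr (b ** b') p)
    = \tsum_(x, c <- Gr b' p) \tsum_(y, d <- Gr b x) H y (d ** c).
Proof.
move=> bH b b' p; have -> : Gr (b ** b') p = mactl (Gamma b) (Gr b' p).
  by apply: QB_inj; rewrite -membMl !Gamma_rP GammaM nmulA.
rewrite -[Gr b' p in LHS]tsum_tpure lin_tsum; last exact: mactl_linear.
rewrite tsum_comp //; apply: eq_tsum => x c.
rewrite -(tsum_tmap id (nmul^~ c)) //; congr tsum; apply: QB_inj.
rewrite -[tmap id _ _]/(mactr (mtens mone (memb c)) (Gr b x)) -membMr.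
by rewrite Gamma_rP -membMl memb_tens -nmulA mtensM mul1m mulm1.
Qed.

Lemma Gamma_lM (Z : lmodType k) (H : Q -> B -> Z) : bilinear2 H ->
  forall b b' p, tsum H (Gl p (b' ** b))
    = \tsum_(x, c <- Gl p b') \tsum_(y, d <- Gl x b) H y (c ** d).
Proof.
move=> bH b b' p; have -> : Gl p (b' ** b) = mactr (Gamma b) (Gl p b').
  by apply: QB_inj; rewrite -membMr !Gamma_lP GammaM nmulA.
rewrite -[Gl p b' in LHS]tsum_tpure lin_tsum; last exact: mactr_linear.
rewrite tsum_comp //; apply: eq_tsum => x c.
rewrite -(tsum_tmap id (nmul c)) //; congr tsum; apply: QB_inj.
rewrite -[tmap id _ _]/(mactl (mtens mone (memb c)) (Gl x b)) -membMl.
by rewrite Gamma_lP -membMr memb_tens nmulA mtensM mul1m mulm1.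
Qed.

(** The values Gamma(b)(x ⊗ 1)(1 ⊗ c) span the range of the left action of
    Gamma(b), and by non-degeneracy this action determines the multiplier. *)
Lemma Gamma_r_inj b b' : (forall p, Gr b p = Gr b' p) -> b = b'.
Proof.
move=> eq_bb'; apply: Gamma_inj.
have eql : mactl (Gamma b) =1 mactl (Gamma b').
  apply: tens_lin_ext => [||x c]; try exact: mactl_linear.
  apply: QB_inj; rewrite -!membMl memb_tens.
  rewrite -[memb x]mulm1 -[memb c]mul1m -mtensM !nmulA -!Gamma_rP.
  by rewrite eq_bb'.
apply: mult_ext => // t; apply: (nondegenerate_extl QB_nondeg) => s.
by rewrite !mactrl eql.
Qed.

Lemma Gamma_l_inj b b' : (forall p, Gl p b = Gl p b') -> b = b'.
Proof.
move=> eq_bb'; apply: Gamma_inj.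
have eqr : mactr (Gamma b) =1 mactr (Gamma b').
  apply: tens_lin_ext => [||x c]; try exact: mactr_linear.
  apply: QB_inj; rewrite -!membMr memb_tens.
  rewrite -[memb x]mul1m -[memb c]mulm1 -mtensM -!nmulA -!Gamma_lP.
  by rewrite eq_bb'.
apply: mult_ext => // t; apply: (nondegenerate_extr QB_nondeg) => s.
by rewrite -!mactrl eqr.
Qed.

End MultiplierCoaction.

(** * The two coactions of a bicomodule algebra *)

Lemma tsum_tassoc (k : fieldType) (U V W Z : lmodType k) (F : U -> V -> W -> Z)
    (t : (U ⊗ V) ⊗ W) : trilinear F ->
  \tsum_(u, s <- tassoc t) \tsum_(v, w <- s) F u v w
  = \tsum_(s, w <- t) \tsum_(u, v <- s) F u v w.
Proof.
move=> triF; have linF (u : U) : bilinear2 (F u) by exact: triF.2.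
rewrite /tassoc tsum_comp; last by lin.
apply: eq_tsum => s w; rewrite tsum_comp; last by lin.
apply: eq_tsum => u v; rewrite tsumE; last by lin.
by rewrite tsumE.
Qed.

Section BicomoduleAlgebra.
Variables (k : fieldType) (Q B : nalgType k).
Hypotheses (Q_units : local_units Q) (B_units : local_units B).
Variable Delta : Q -> multiplier (Q ⊗ Q).
Hypothesis Q_hopf : multiplier_hopf Delta.
Variables (Gamma : B -> multiplier (Q ⊗ B)) (Upsilon : B -> multiplier (B ⊗ Q)).
Hypothesis B_bicomod : bicomodule_algebra Delta Gamma Upsilon.

Local Notation T1f := (fun x y => T1 Delta (x ⊗ y)).
Local Notation T2f := (fun x y => T2 Delta (x ⊗ y)).

(** A right coaction of Q is a left coaction of Q with the opposite coproduct;
    stated for this one, the lemmas on left coactions apply to Upsilon too. *)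
Definition swapped_coaction (b : B) : multiplier (Q ⊗ B) := mswap (Upsilon b).
Local Notation Upsilon' := swapped_coaction.

Let Gamma_inj : injective Gamma. Proof. by have [[]] := B_bicomod. Qed.
Let Gamma_hom : algebra_hom Gamma. Proof. by have [[]] := B_bicomod. Qed.
Let Gamma_in b x : inA (Gamma b ** mtens (memb x) mone) /\
  inA (mtens (memb x) mone ** Gamma b).
Proof. by have [[]] := B_bicomod. Qed.

Let Upsilon'_inj : injective Upsilon'.
Proof. by have [_ [inj _ _ _] _] := B_bicomod; move=> b b' /mswap_inj/inj. Qed.

Let Upsilon'_hom : algebra_hom Upsilon'.
Proof.
have [_ [_ [lin mul] _ _] _] := B_bicomod; split=> [c b b'|b b'].
  by rewrite /Upsilon' lin mswap_linear.
by rewrite /Upsilon' mul mswapM.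
Qed.

Let Upsilon'_in b x : inA (Upsilon' b ** mtens (memb x) mone) /\
  inA (mtens (memb x) mone ** Upsilon' b).
Proof.
have [_ [_ _ /(_ b x)[[t et] [s es]] _] _] := B_bicomod.
rewrite /Upsilon' -(mswap_tens mone (memb x)) -!mswapM et es !mswap_memb.
by split; eexists.
Qed.

Let QB_inj : injective (@memb k (tensor Q B)).
Proof. exact/memb_inj/tens_nondegenerate. Qed.

Lemma Upsilon_rE b x : tswap (Upsilon_r Upsilon b x) = Gamma_r Upsilon' b x.
Proof.
have [_ [_ _ /(_ b x)/proj1/eltP eP _] _] := B_bicomod.
apply: QB_inj; rewrite -mswap_memb eP (Gamma_rP Upsilon'_in).
by rewrite mswapM mswap_tens.
Qed.

Lemma Upsilon_lE x b : tswap (Upsilon_l Upsilon x b) = Gamma_l Upsilon' x b.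
Proof.
have [_ [_ _ /(_ b x)/proj2/eltP eP _] _] := B_bicomod.
apply: QB_inj; rewrite -mswap_memb eP (Gamma_lP Upsilon'_in).
by rewrite mswapM mswap_tens.
Qed.

Let T1_lin := T1_linear Q_units Q_hopf.
Let T2_lin := T2_linear Q_units Q_hopf.
Let Gr_bil := Gamma_r_bilinear Q_units B_units Gamma_hom Gamma_in.
Let Gl_bil := Gamma_l_bilinear Q_units B_units Gamma_hom Gamma_in.
Let Ur_bil := Gamma_r_bilinear Q_units B_units Upsilon'_hom Upsilon'_in.
Let Ul_bil := Gamma_l_bilinear Q_units B_units Upsilon'_hom Upsilon'_in.
Let T1_det := bijective_det (T1_linear Q_units Q_hopf)
  (let: And5 _ _ _ T1_bij _ := Q_hopf in T1_bij).

Let Gamma_coassociative : coassociative T1f (Gamma_r Gamma).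
Proof.
move=> Z F triF b p r; have [[_ _ _ /(_ b p r) coassoc] _ _] := B_bicomod.
transitivity (\tsum_(u, s <- \tsum_(x, y <- T1 Delta (p ⊗ r))
    \tsum_(q, c <- Gamma_r Gamma b x) q ⊗ Gamma_r Gamma c y)
    \tsum_(v, d <- s) F u v d).
  rewrite tsum_comp; last by lin.
  apply: eq_tsum => x y; rewrite tsum_comp; last by lin.
  by apply: eq_tsum => u c; rewrite tsumE //; lin.
rewrite coassoc tsum_tassoc // tsum_comp; last by lin.
by apply: eq_tsum => q c; rewrite tsumE //; lin.
Qed.

Let Upsilon_coassociative :
  coassociative (fun x y => tswap (T1f x y)) (Gamma_r Upsilon').
Proof.
move=> Z F triF b p r; have [_ [_ _ _ /(_ b p r) coassoc] _] := B_bicomod.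
transitivity (\tsum_(d, s <- tassoc (\tsum_(x, y <- T1 Delta (p ⊗ r))
    \tsum_(c, q <- Upsilon_r Upsilon b y) Upsilon_r Upsilon c x ⊗ q))
    \tsum_(u, v <- s) F v u d).
  rewrite tsum_tassoc; last by lin.
  rewrite tsum_comp; last by lin.
  rewrite tsum_tswap; last by lin.
  apply: eq_tsum => y x; rewrite tsum_comp; last by lin.
  rewrite -Upsilon_rE tsum_tswap; last by lin.
  apply: eq_tsum => c v; rewrite tsumE; last by lin.
  by rewrite -Upsilon_rE tsum_tswap //; lin.
rewrite coassoc tsum_comp; last by lin.
rewrite -Upsilon_rE tsum_tswap; last by lin.
apply: eq_tsum => c q; rewrite tsumE; last by lin.
by rewrite tsum_tswap //; lin.
Qed.

Lemma covered_coaction_l : covered_coaction (@nmul k Q) (@nmul k B) T1f T2f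
  (Gamma_r Gamma) (Gamma_l Gamma).
Proof.
split=> //.
- by apply: Gamma_lr.
- by apply: Gamma_rM.
- by apply: Gamma_rX.
- by apply: Gamma_r_inj.
apply: (coassociative_transfer Q_units B_units (T := T1f)
  (D := fun p x r => tmap (nmul p) id (T1f x r)) (G := Gamma_r Gamma)) => //.
- by move=> p r; rewrite /tmap; lin.
- by move=> *; apply: T2_T1_mul.
- by move=> *; apply: Gamma_lr.
Qed.

(** The opposite products of Q and B exchange the covers on the left and on the
    right: what is (x ⊗ 1)Gamma(b) for the flipped coaction Gamma becomes
    Gamma(b)(x ⊗ 1). *)
Lemma covered_coaction_r : covered_coaction
  (fun x y : Q => y ** x) (fun b c : B => c ** b)
  (fun x y => tswap (T2f y x)) (fun x y => tswap (T1f y x))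
  (fun b x => Gamma_l Upsilon' x b) (fun x b => Gamma_r Upsilon' b x).
Proof.
split=> //; try by lin.
- by move=> Z H bH q g b; rewrite (Gamma_lr Q_units B_units Upsilon'_in).
- by move=> Z H bH b b' p; rewrite (Gamma_lM Q_units B_units Upsilon'_hom Upsilon'_in).
- by move=> Z H bH b p r; rewrite (Gamma_lX Q_units B_units Upsilon'_in).
- by apply: Gamma_l_inj.
apply: (coassociative_transfer Q_units B_units (T := fun x y => tswap (T1f x y))
  (D := fun p x r => tswap (tmap (nmul p) id (T1f x r)))
  (G := Gamma_r Upsilon')) => //; try by lin.
- move=> Z f g bf bg fg x y; move: y x.
  apply: (T1_det (f := fun y x => f x y) (g := fun y x => g x y)); try by lin.
  by move=> u v; have := fg u v; rewrite !tsum_tswap.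
- by move=> p r; rewrite /tmap; lin.
- by move=> *; rewrite -tswapM (T2_T1_mul Q_units Q_hopf).
- by move=> *; apply: Gamma_lr.
Qed.

(** The bicomodule axiom, with Upsilon covered on the right, becomes the same
    statement with Upsilon covered on the left after multiplication by an
    element g of Q, which [Gamma_lr] carries from one cover to the other. *)
Lemma coactions_commute (Z : lmodType k) (F : Q -> Q -> B -> Z) : trilinear F ->
  forall b x y,
  \tsum_(q, c <- Gamma_r Gamma b x) \tsum_(z, d <- Gamma_l Upsilon' y c) F q z d
  = \tsum_(z, c <- Gamma_l Upsilon' y b) \tsum_(q, d <- Gamma_r Gamma c x) F q z d.
Proof.
have right_covered (Y : lmodType k) (K : Q -> Q -> B -> Y) : trilinear K ->
  forall b x y,
  \tsum_(q, c <- Gamma_r Gamma b x) \tsum_(z, d <- Gamma_r Upsilon' c y) K q z d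
  = \tsum_(z, c <- Gamma_r Upsilon' b y) \tsum_(q, d <- Gamma_r Gamma c x) K q z d.
  move=> triK b x y; have [_ _ /(_ b x y) comm] := B_bicomod.
  transitivity (\tsum_(q, s <- \tsum_(q, c <- Gamma_r Gamma b x)
      q ⊗ Upsilon_r Upsilon c y) \tsum_(d, z <- s) K q z d).
    rewrite tsum_comp; last by lin.
    apply: eq_tsum => q c; rewrite tsumE; last by lin.
    by rewrite -Upsilon_rE tsum_tswap //; lin.
  rewrite comm tsum_tassoc; last by lin.
  rewrite tsum_comp; last by lin.
  rewrite -Upsilon_rE tsum_tswap; last by lin.
  by apply: eq_tsum => z c; rewrite tsumE //; lin.
move=> triF b x y.
suff main :
    \tsum_(q, c <- Gamma_r Gamma b x) \tsum_(z, d <- Gamma_l Upsilon' y c)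
      (q ⊗ z) ⊗ d
    = \tsum_(z, c <- Gamma_l Upsilon' y b) \tsum_(q, d <- Gamma_r Gamma c x)
      (q ⊗ z) ⊗ d.
  pose Phi (t : (Q ⊗ Q) ⊗ B) := \tsum_(s, d <- t) \tsum_(u, v <- s) F u v d.
  have Phi_bil : bilinear2 (fun s d => \tsum_(u, v <- s) F u v d) by lin.
  transitivity (Phi (\tsum_(q, c <- Gamma_r Gamma b x)
      \tsum_(z, d <- Gamma_l Upsilon' y c) (q ⊗ z) ⊗ d)).
    rewrite /Phi; do 2![rewrite tsum_comp //; apply: eq_tsum => ? ?].
    by rewrite !tsumE //; lin.
  rewrite main /Phi; do 2![rewrite tsum_comp //; apply: eq_tsum => ? ?].
  by rewrite !tsumE //; lin.
set s1 := LHS; set s2 := RHS.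
apply: (nondegenerate_extl (tens_nondegenerate (tens_local_units Q_units Q_units)
  B_units)).
apply: tens_lin_ext => [||t e]; try by lin.
move: t; apply: tens_lin_ext => [||u g]; try by lin.
pose K q z d := ((q ** u) ⊗ (y ** z)) ⊗ (d ** e).
have triK : trilinear K by rewrite /K; lin.
transitivity (\tsum_(q, c <- Gamma_r Gamma b x)
    \tsum_(z, d <- Gamma_r Upsilon' c g) K q z d).
  rewrite /s1 (lin_tsum (g := nmul^~ _)); last by lin.
  apply: eq_tsum => q c; rewrite (lin_tsum (g := nmul^~ _)); last by lin.
  rewrite -(Gamma_lr Q_units B_units Upsilon'_in
    (H := fun z d => ((q ** u) ⊗ z) ⊗ (d ** e))); last by lin.
  by apply: eq_tsum => z d; rewrite !tens_mulE.
rewrite right_covered // /s2 (lin_tsum (g := nmul^~ _)); last by lin.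
rewrite -(Gamma_lr Q_units B_units Upsilon'_in
  (H := fun z c => \tsum_(q, d <- Gamma_r Gamma c x)
    ((q ** u) ⊗ z) ⊗ (d ** e))); last by lin.
apply: eq_tsum => z c; rewrite (lin_tsum (g := nmul^~ _)); last by lin.
by apply: eq_tsum => q d; rewrite !tens_mulE.
Qed.

End BicomoduleAlgebra.

(** * The isomorphisms *)

Section Isomorphisms.
Variables (k : fieldType) (Q A B : nalgType k).
Hypotheses (Q_units : local_units Q) (B_units : local_units B).
Variable Delta : Q -> multiplier (Q ⊗ Q).
Hypothesis Q_hopf : multiplier_hopf Delta.
Variables S Sinv : Q -> Q.
Hypothesis S_antipode : is_antipode Delta S.
Hypotheses (SK : cancel S Sinv) (SinvK : cancel Sinv S).
Variables (lact : Q -> A -> A) (ract : A -> Q -> A).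
Hypothesis A_bimod : bimodule_algebra Delta lact ract.
Variables (Gamma : B -> multiplier (Q ⊗ B)) (Upsilon : B -> multiplier (B ⊗ Q)).
Hypothesis B_bicomod : bicomodule_algebra Delta Gamma Upsilon.
Variable eps : Q -> k.
Hypothesis hopf_l : covered_hopf (@nmul k Q) (fun x y => T1 Delta (x ⊗ y))
  (fun x y => T2 Delta (x ⊗ y)) eps S Sinv.

Let Ups := swapped_coaction Upsilon.
Let racto (x : Q) (a : A) : A := ract a x.
Let lu : A -> Q := lunit lact.
Let ru : A -> Q := runit ract.

Let hopf_r := covered_hopf_mirror hopf_l.
Let Sinv_lin := hopf_Sinv_linear hopf_l.
Let coact_l := covered_coaction_l Q_units B_units Q_hopf B_bicomod.
Let coact_r := covered_coaction_r Q_units B_units Q_hopf B_bicomod.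

Let lact_bil : bilinear2 lact. Proof. by have [[]] := A_bimod. Qed.
Let ract_bil : bilinear2 ract. Proof. by have [_ []] := A_bimod. Qed.
Let lactA x y a : lact (x ** y) a = lact x (lact y a).
Proof. by have [[_ ->]] := A_bimod. Qed.
Let lactM x p a b : lact x (a ** lact p b)
  = \tsum_(u, v <- T1 Delta (x ⊗ p)) (lact u a ** lact v b).
Proof. by have [[_ _ _ ->]] := A_bimod. Qed.
Let lractC x a y : ract (lact x a) y = lact x (ract a y).
Proof. by have [_ _ ->] := A_bimod. Qed.
Let lu_id a : lact (lu a) a = a. Proof. exact: (lunitP Q_units A_bimod). Qed.
Let ru_id a : ract a (ru a) = a. Proof. exact: (runitP Q_units A_bimod). Qed.

Let mulA_bil := @nmul_bilinear k A.
Let mulB_bil := @nmul_bilinear k B.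
Let mulAo_bil : bilinear2 (fun x y : A => y ** x). Proof. by lin. Qed.
Let mulBo_bil : bilinear2 (fun x y : B => y ** x). Proof. by lin. Qed.
Let racto_bil : bilinear2 racto. Proof. by rewrite /racto; lin. Qed.
Let ractoA x y a : racto (y ** x) a = racto x (racto y a).
Proof. by have [_ [_ /(_ a y x)]] := A_bimod. Qed.
Let ractoM x p a b : racto x (racto p b ** a)
  = \tsum_(u, v <- tswap (T2 Delta (p ⊗ x))) (racto v b ** racto u a).
Proof.
have [_ [_ _ _ ractM] _] := A_bimod.
by rewrite tsum_tswap; [exact: ractM|lin].
Qed.

Let lam := coact_twist (Gamma_r Gamma) lact lu.
Let sig := coact_twist_inv S Sinv (Gamma_l Gamma) lact lu.
Let rho := coact_twist (fun b x => Gamma_l Ups x b) racto ru.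
Let tau := coact_twist_inv S Sinv (fun x b => Gamma_r Ups b x) racto ru.

Let lam_bil : bilinear2 lam :=
  coact_twist_bilinear hopf_l coact_l lact_bil lactA lu_id.
Let rho_bil : bilinear2 rho :=
  coact_twist_bilinear hopf_r coact_r racto_bil ractoA ru_id.
Let sig_bil : bilinear2 sig :=
  coact_twist_inv_bilinear hopf_l coact_l lact_bil lactA lu_id.
Let tau_bil : bilinear2 tau :=
  coact_twist_inv_bilinear hopf_r coact_r racto_bil ractoA ru_id.

Let lamE c q b : lam (lact q c) b
  = \tsum_(x, b0 <- Gamma_r Gamma b q) b0 ⊗ lact x c.
Proof. exact: (coact_twistE hopf_l coact_l lact_bil lactA lu_id). Qed.
Let rhoE c q b : rho (ract c q) b
  = \tsum_(x, b0 <- Gamma_l Ups q b) b0 ⊗ ract c x.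
Proof. exact: (coact_twistE hopf_r coact_r racto_bil ractoA ru_id). Qed.
Let sigE c q b : sig (lact q c) b
  = \tsum_(z, b0 <- Gamma_l Gamma (S q) b) b0 ⊗ lact (Sinv z) c.
Proof. exact: (coact_twist_invE hopf_l coact_l lact_bil lactA lu_id). Qed.
Let tauE c q b : tau (ract c q) b
  = \tsum_(z, b0 <- Gamma_r Ups b (S q)) b0 ⊗ ract c (Sinv z).
Proof. exact: (coact_twist_invE hopf_r coact_r racto_bil ractoA ru_id). Qed.

Let UrE b x : tswap (Upsilon_r Upsilon b x) = Gamma_r Ups b x.
Proof. exact: (Upsilon_rE Q_units B_units B_bicomod). Qed.
Let UlE x b : tswap (Upsilon_l Upsilon x b) = Gamma_l Ups x b.
Proof. exact: (Upsilon_lE Q_units B_units B_bicomod). Qed.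

Let coact_comm (Z : lmodType k) (F : A -> A -> B -> Z) : trilinear F ->
  forall a a' b,
  \tsum_(b0, c <- lam a b) \tsum_(b00, c' <- rho a' b0) F c c' b00
  = \tsum_(b0, c' <- rho a' b) \tsum_(b00, c <- lam a b0) F c c' b00.
Proof.
move=> triF a a' b; rewrite -[a]lu_id -[a']ru_id.
rewrite lamE rhoE !tsum_comp; try by lin.
transitivity (\tsum_(q, c <- Gamma_r Gamma b (lu a))
  \tsum_(z, d <- Gamma_l Ups (ru a') c)
    F (lact q a) (ract a' z) d).
  apply: eq_tsum => q c; rewrite tsumE; last by lin.
  rewrite rhoE tsum_comp; last by lin.
  by apply: eq_tsum => z d; rewrite tsumE //; lin.
rewrite (coactions_commute Q_units B_units B_bicomod
  (F := fun q z d => F (lact q a) (ract a' z) d)); last by lin.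
apply: eq_tsum => z c; rewrite tsumE; last by lin.
rewrite lamE tsum_comp; last by lin.
by apply: eq_tsum => q d; rewrite tsumE //; lin.
Qed.

(** Each of lam and rho is covered by an element acting on a; since the two
    actions commute, these covers survive the other action. *)
Let act_comm (Z : lmodType k) (F : B -> B -> A -> Z) : trilinear F ->
  forall a b b',
  \tsum_(b0, c <- lam a b) \tsum_(b'0, d <- rho c b') F b0 b'0 d
  = \tsum_(b'0, c <- rho a b') \tsum_(b0, d <- lam c b) F b0 b'0 d.
Proof.
move=> triF a b b'.
have lam_a : lam a b = \tsum_(x, b0 <- Gamma_r Gamma b (lu a)) b0 ⊗ lact x a.
  by rewrite -lamE lu_id.
have rho_a : rho a b' =
    \tsum_(y, b'0 <- Gamma_l Ups (ru a) b') b'0 ⊗ ract a y.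
  by rewrite -rhoE ru_id.
have lam_ay y : lam (ract a y) b =
    \tsum_(x, b0 <- Gamma_r Gamma b (lu a)) b0 ⊗ lact x (ract a y).
  by rewrite -lamE -lractC lu_id.
have rho_xa x : rho (lact x a) b' =
    \tsum_(y, b'0 <- Gamma_l Ups (ru a) b') b'0 ⊗ ract (lact x a) y.
  by rewrite -rhoE lractC ru_id.
transitivity (\tsum_(x, b0 <- Gamma_r Gamma b (lu a))
    \tsum_(y, b'0 <- Gamma_l Ups (ru a) b') F b0 b'0 (lact x (ract a y))).
  rewrite lam_a tsum_comp; last by lin.
  apply: eq_tsum => x b0; rewrite tsumE; last by lin.
  rewrite rho_xa tsum_comp; last by lin.
  by apply: eq_tsum => y b'0; rewrite tsumE ?lractC //; lin.
rewrite tsum_exchange rho_a tsum_comp; last by lin.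
apply: eq_tsum => y b'0; rewrite tsumE; last by lin.
rewrite lam_ay tsum_comp; last by lin.
by apply: eq_tsum => x b0; rewrite tsumE //; lin.
Qed.

Lemma diamond_star_r_iso : exists f,
  algebra_iso (diamond_r lact ract Gamma Upsilon)
    (star_r S Sinv lact ract Gamma Upsilon) f.
Proof.
apply: (twisted_products_iso (mA := @nmul k A) (mB := @nmul k B)
  (lam := lam) (rho := rho) (sig := sig)) => //.
- exact: (coact_twist_invK hopf_l coact_l).
- exact: (coact_twistK hopf_l coact_l).
- exact: (coact_twist_mulB hopf_l coact_l).
- exact: (coact_twist_mulA hopf_l coact_l).
- exact: (diamond_r_bilinear Q_units B_units A_bimod B_bicomod).
- exact: (star_r_bilinear Q_units B_units S_antipode SK SinvK A_bimod B_bicomod).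
- move=> b' a' b a; rewrite -[in LHS](ru_id a') -[in LHS](lu_id a).
  rewrite (diamond_rE Q_units B_units A_bimod B_bicomod).
  rewrite -[in RHS](ru_id a') -[in RHS](lu_id a) lamE rhoE.
  rewrite tsum_comp; last by lin.
  apply: eq_tsum => x b'0; rewrite tsumE; last by lin.
  rewrite tsum_comp -?UlE; last by lin.
  rewrite tsum_tswap; last by lin.
  by apply: eq_tsum => b0 y; rewrite tsumE //; lin.
- move=> b' a' b a.
  have Ea : a' = ract (lact (lu a') a') (ru a') by rewrite lu_id ru_id.
  rewrite [in LHS]Ea.
  rewrite (star_rE Q_units B_units S_antipode SK SinvK A_bimod B_bicomod).
  rewrite -[in RHS](ru_id a') rhoE tsum_comp -?UlE; last by lin.
  rewrite tsum_tswap; last by lin.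
  apply: eq_tsum => b0 y; rewrite tsumE; last by lin.
  have -> : ract a' y = lact (lu a') (ract a' y) by rewrite -lractC lu_id.
  rewrite sigE tsum_comp; last by lin.
  by apply: eq_tsum => z b00; rewrite tsumE ?lractC //; lin.
Qed.

(** The flip A ⊗ B -> B ⊗ A is an anti-isomorphism from the left-handed products
    to the right-handed ones built on the opposite algebras. *)
Lemma diamond_star_l_iso : exists g,
  algebra_iso (diamond_l lact ract Gamma Upsilon)
    (star_l S Sinv lact ract Gamma Upsilon) g.
Proof.
pose mu s t := tswap (diamond_l lact ract Gamma Upsilon (tswap t) (tswap s)).
pose nu s t := tswap (star_l S Sinv lact ract Gamma Upsilon (tswap t) (tswap s)).
have diamond_l_bil := diamond_l_bilinear Q_units B_units A_bimod B_bicomod.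
have star_l_bil := star_l_bilinear Q_units B_units S_antipode SK SinvK A_bimod B_bicomod.
have [g [g_lin [g' gK g'K] gM]] : exists g, algebra_iso mu nu g.
  apply: (twisted_products_iso (mA := fun x y : A => y ** x)
    (mB := fun x y : B => y ** x) (lam := rho) (rho := lam) (sig := tau)) => //.
  - exact: (coact_twist_invK hopf_r coact_r).
  - exact: (coact_twistK hopf_r coact_r).
  - exact: (coact_twist_mulB hopf_r coact_r).
  - exact: (coact_twist_mulA hopf_r coact_r).
  - move=> Z F triF a a' b.
    by rewrite (coact_comm (F := fun c c' b00 => F c' c b00)) //; lin.
  - move=> Z F triF a b b'.
    by rewrite (act_comm (F := fun b0 b'0 d => F b'0 b0 d)) //; lin.
  - by rewrite /mu; lin.
  - by rewrite /nu; lin.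
  - move=> b' a' b a; rewrite /mu !tswapE.
    rewrite -[in LHS](ru_id a) -[in LHS](lu_id a').
    rewrite (diamond_lE Q_units B_units A_bimod B_bicomod).
    rewrite -[in RHS](ru_id a) -[in RHS](lu_id a') lamE rhoE [RHS]tsum_exchange.
    rewrite (lin_tsum (g := @tswap k A B)); last exact: tswap_linear.
    rewrite tsum_comp; last by lin.
    apply: eq_tsum => x b0; rewrite tsumE; last by lin.
    rewrite (lin_tsum (g := @tswap k A B)); last exact: tswap_linear.
    rewrite tsum_comp -?UlE; last by lin.
    rewrite tsum_tswap; last by lin.
    by apply: eq_tsum => b'0 y; rewrite tswapE tsumE //; lin.
  - move=> b' a' b a; rewrite /nu !tswapE.
    have Ea : a' = ract (lact (lu a') a') (ru a') by rewrite lu_id ru_id.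
    rewrite [in LHS]Ea.
    rewrite (star_lE Q_units B_units S_antipode SK SinvK A_bimod B_bicomod).
    rewrite -[in RHS](lu_id a') lamE.
    rewrite (lin_tsum (g := @tswap k A B)); last exact: tswap_linear.
    rewrite tsum_comp; last by lin.
    apply: eq_tsum => x b0; rewrite tsumE; last by lin.
    rewrite -[in RHS](ru_id a') -[in RHS]lractC tauE.
    rewrite (lin_tsum (g := @tswap k A B)); last exact: tswap_linear.
    rewrite tsum_comp -?UrE; last by lin.
    rewrite tsum_tswap; last by lin.
    apply: eq_tsum => b00 z; rewrite tswapE tsumE //; last by lin.
exists (fun t => tswap (g (tswap t))); split.
- by lin.
- exists (fun t => tswap (g' (tswap t))) => t; by rewrite tswapK ?gK ?g'K tswapK.
- move=> s t.
  have := gM (tswap t) (tswap s); rewrite /mu /nu !tswapK => ->.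
  by rewrite !tswapK.
Qed.

End Isomorphisms.

Theorem proposition2p4p3 (k : fieldType) (Q A B : nalgType k)
    (Q_nondeg : nondegenerate_product Q) (Q_units : local_units Q)
    (A_nondeg : nondegenerate_product A) (A_units : local_units A)
    (B_nondeg : nondegenerate_product B) (B_units : local_units B)
    (Delta : Q -> multiplier (Q ⊗ Q))
    (Q_hopf : regular_multiplier_hopf Delta)
    (S Sinv : Q -> Q) (S_antipode : is_antipode Delta S)
    (SK : cancel S Sinv) (SinvK : cancel Sinv S)
    (lact : Q -> A -> A) (ract : A -> Q -> A)
    (A_bimod : bimodule_algebra Delta lact ract)
    (Gamma : B -> multiplier (Q ⊗ B)) (Upsilon : B -> multiplier (B ⊗ Q))
    (B_bicomod : bicomodule_algebra Delta Gamma Upsilon) :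
  (exists f : B ⊗ A -> B ⊗ A,
     algebra_iso (diamond_r lact ract Gamma Upsilon)
                 (star_r S Sinv lact ract Gamma Upsilon) f) /\
  (exists g : A ⊗ B -> A ⊗ B,
     algebra_iso (diamond_l lact ract Gamma Upsilon)
                 (star_l S Sinv lact ract Gamma Upsilon) g).
Proof.
have [hopf _] := Q_hopf.
have [eps hopf_l] := multiplier_hopf_covered Q_units hopf S_antipode SK SinvK.
split.
- exact: (diamond_star_r_iso Q_units B_units hopf S_antipode SK SinvK A_bimod
    B_bicomod hopf_l).
- exact: (diamond_star_l_iso Q_units B_units hopf S_antipode SK SinvK A_bimod
    B_bicomod hopf_l).
Qed.
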